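(* Let $X$ be a Polish space and $N\ge k\ge2$. A measure $\mu_k\in\mathcal P(X^k)$ is $N$-representable if and only if there exists $\alpha\in\mathcal P(\mathcal P(X))$ such that $\alpha(\mathcal P_{\frac1N}(X))=1$ and $$\mu_k=\int_{\mathcal P_{\frac1N}(X)}F_{N,k}(\lambda)\,d\alpha(\lambda).$$ Moreover, if $k=N$, the measure $\alpha$ in this representation is unique.
   Context: $\mathcal P(Y)$ denotes the set of Borel probability measures on a Polish space $Y$, with the narrow topology (convergence tested against bounded continuous functions); $\mathcal P(X)$ is then itself Polish. For $\gamma\in\mathcal P(X^N)$ and a permutation $\sigma$ of $\{1,\dots,N\}$, $\gamma^\sigma$ is defined by $\int\varphi\,d\gamma^\sigma=\int\varphi(x_{\sigma(1)},\dots,x_{\sigma(N)})\,d\gamma$; $S_N\gamma=\frac1{N!}\sum_\sigma\gamma^\sigma$ (analogously $S_k$ on $X^k$, extended linearly to finite signed measures); $\gamma$ is symmetric if $S_N\gamma=\gamma$. $M_k\gamma$ is the $k$-point marginal $(M_k\gamma)(A)=\gamma(A\times X^{N-k})$. A measure $\mu_k\in\mathcal P(X^k)$ is $N$-representable if $\mu_k=M_k\gamma$ for some symmetric $\gamma\in\mathcal P(X^N)$. $\mathcal P_{\frac1N}(X)=\{\frac1N\sum_{i=1}^N\delta_{x_i}: x_1,\dots,x_N\in X\text{ not necessarily distinct}\}$. For $\lambda\in\mathcal P(X)$, $\lambda^{\otimes m}$ is the $m$-fold product (factor omitted if $m=0$) and $\mathrm{id}^{\otimes m}_\#\lambda$ the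 push-forward of $\lambda$ under $x\mapsto(x,\dots,x)\in X^m$. A partition of $j\in\mathbb N$ of length $n$ is $\mathbf p=(p_1\ge\dots\ge p_n)\in\mathbb N^n$ ($\mathbb N=\{1,2,\dots\}$) with $\sum p_i=j$; $n(\mathbf p)=n$; $\mathrm{Ran}\,\mathbf p$ is the set of values of its components and $|\mathbf p^{-1}(q)|$ the number of components equal to $q$. Define, for every $\lambda\in\mathcal P(X)$, the (signed) measure $$F_{N,k}(\lambda)=\frac{N^{k-1}}{\prod_{i=1}^{k-1}(N-i)}\Big[\lambda^{\otimes k}+\sum_{j=1}^{k-1}\frac{(-1)^j}{N^j}S_kP_j^{(k)}(\lambda)\Big],$$ $$P_j^{(k)}(\lambda)=\sum_{\substack{\mathbf p\text{ partition of }j\\ j+n(\mathbf p)\le k}}d_{\mathbf p}^{(k)}\,\mathrm{id}^{\otimes(p_1+1)}_\#\lambda\otimes\cdots\otimes\mathrm{id}^{\otimes(p_{n(\mathbf p)}+1)}_\#\lambda\otimes\lambda^{\otimes(k-j-n(\mathbf p))},$$ $$d_{\mathbf p}^{(k)}=\frac{k!}{(k-j-n(\mathbf p))!}\prod_{i=1}^{n(\mathbf p)}\frac1{p_i+1}\prod_{q\in\mathrm{Ran}\,\mathbf p}\frac1{(|\mathbf p^{-1}(q)|)!}.$$ The integral formula means: for every bounded continuous $\varphi$ on $X^k$, $\int_{X^k}\varphi\,d\mu_k=\int_{\mathcal P_{1/N}(X)}\big(\int_{X^k}\varphi\,dF_{N,k}(\lambda)\big)d\alpha(\lambda)$. *)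

(* Defs.v *)
From HB Require Import structures.
From mathcomp Require Import all_boot all_order all_algebra perm.
From mathcomp Require Import all_classical all_reals all_analysis.
Import Order.TTheory GRing.Theory Num.Theory.
Import numFieldNormedType.Exports.

Set Implicit Arguments.
Unset Strict Implicit.
Unset Printing Implicit Defensive.

Local Open Scope classical_set_scope.
Local Open Scope ring_scope.

Definition metrizes (R : realType) (T : topologicalType) (d : T -> T -> R) :=
  [/\ forall x y, d x y = 0 <-> x = y,
      forall x y, d x y = d y x,
      forall x y z, d x z <= d x y + d y z &
      forall x, nbhs x =
        filter_from [set e : R | 0 < e] (fun e => [set y | d x y < e])].

Definition complete_metric (R : realType) (T : topologicalType)
    (d : T -> T -> R) :=
  forall u : nat -> T,
    (forall e : R, 0 < e -> exists n0 : nat, forall m n : nat,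
      (n0 <= m)%N -> (n0 <= n)%N -> d (u m) (u n) < e) ->
    exists l : T, u @ \oo --> l.

(* Measurable types are pointed in this library, hence the base point; on the
   empty space there is no probability measure. *)
HB.mixin Record isPolish (R : realType) T of PointedTopological T := {
  polish_separable : exists2 D : set T, countable D & dense D;
  polish_completely_metrizable :
    exists2 d : T -> T -> R, metrizes d & complete_metric d
}.

#[short(type="polishType")]
HB.structure Definition Polish (R : realType) :=
  {T of PointedTopological T & isPolish R T}.

Lemma polish_second_countable (R : realType) (X : polishType R) :
  @second_countable X.
Proof.
have [D cD dD] := @polish_separable R X.
have [d [d0 dC dT dN] _] := @polish_completely_metrizable R X.
pose b (p : X * nat) := [set y | d p.1 y < p.2.+1%:R^-1].
have oball (x : X) (e : R) : open [set y | d x y < e].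
  rewrite openE => y /= dxy; rewrite /interior dN.
  exists (e - d x y); first by rewrite /= subr_gt0.
  by move=> z /= dyz; apply: le_lt_trans (dT x y z) _; rewrite -ltrBrDl.
exists [set b p | p in D `*` [set: nat]].
  exact: sub_countable (card_image_le _ _) (countableX cD (countableP _)).
split=> [_ [p _ <-]|x U]; first exact: oball.
rewrite {1}dN => -[e /= e0 eU].
have e20 : 0 < e / 2 by rewrite divr_gt0.
have [n] := ltr_add_invr e20; rewrite add0r => ne.
have n0 : (0 : R) < n.+1%:R^-1 by rewrite invr_gt0.
have [|y [xy Dy]] := dD [set y | d x y < n.+1%:R^-1] _ (oball _ _).
  by exists x; rewrite /= (d0 x x).2.
exists (b (y, n)).
  by split; [exists (y, n) | rewrite /b /= dC].
move=> z; rewrite /b /= => yz; apply: eU => /=.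
apply: le_lt_trans (dT x y z) _; rewrite [e]splitr; apply: ltrD.
  exact: lt_trans xy ne.
exact: lt_trans yz ne.
Qed.

Notation borel Y := (g_sigma_algebraType (@open Y)).

Lemma continuous_borel (Y Z : ptopologicalType) (f : Y -> Z) :
  continuous f -> measurable_fun setT (f : borel Y -> borel Z).
Proof.
move=> /continuousP cf.
apply: (@measurability _ _ (borel Y) (borel Z) setT f (@open Z)) => //.
by move=> _ [U oU <-]; rewrite setTI; apply: sub_sigma_algebra; exact: cf.
Qed.

Definition pow (X : Type) (n : nat) : Type := {ptws 'I_n -> X}.
HB.instance Definition _ (X : topologicalType) (n : nat) :=
  Topological.on (pow X n).
HB.instance Definition _ (X : ptopologicalType) (n : nat) :=
  isPointed.Build (pow X n) (fun=> point).

Lemma pow_nbhs_box (X : ptopologicalType) n (x : pow X n) (U : set (pow X n)) :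
  nbhs x U -> exists2 V : 'I_n -> set X,
    (forall i, nbhs (x i) (V i)) & [set y | forall i, V i (y i)] `<=` U.
Proof.
pose F := filter_from [set V : 'I_n -> set X | forall i, nbhs (x i) (V i)]
  (fun V => [set y : pow X n | forall i, V i (y i)]).
have FF : Filter F.
  apply: filter_from_filter; first by exists (fun=> setT) => i; exact: filterT.
  move=> V W nV nW; exists (fun i => V i `&` W i).
    by move=> i; apply: filterI; [exact: nV|exact: nW].
  by move=> y VWy; split=> i; have [] := VWy i.
suff Fx : F --> x by move=> /Fx[V nV VU]; exists V.
apply/cvg_sup => i A; rewrite nbhsE /= => -[_ [[B oB <-] Bx] BA].
exists (fun j => if j == i then B else setT).
  by move=> j /=; case: eqP => [->|_]; [exact: open_nbhs_nbhs|exact: filterT].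
by move=> y /(_ i); rewrite eqxx => By; exact: BA.
Qed.

Lemma measurable_pow (R : realType) (X : polishType R) n d
    (T : measurableType d) (f : T -> pow X n) :
  (forall i, measurable_fun setT ((fun t => f t i) : T -> borel X)) ->
  measurable_fun setT (f : T -> borel (pow X n)).
Proof.
move=> mf.
apply: (@measurability _ _ T (borel (pow X n)) setT f (@open (pow X n))) => //.
move=> _ [U oU <-]; rewrite setTI.
have [B cB [Bo Bb]] := @polish_second_countable R X.
have [B0|[e]] := elimT pfcard_geP cB.
  by have [V [+ _] _] := Bb point setT filterT; rewrite B0.
have eB m : B (e m) by exact: funS.
pose box (b : {ffun 'I_n -> nat}) :=
  [set y : pow X n | forall i, e (b i) (y i)].
rewrite (_ : f @^-1` U = \bigcup_(b in [set: {ffun 'I_n -> nat}])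
    (f @^-1` [set y | box b y /\ box b `<=` U])); last first.
  apply/seteqP; split=> t /=; last by case=> b _ [fb bU]; exact: bU.
  move=> Uft; have [V nV VU] := pow_nbhs_box (open_nbhs_nbhs (conj oU Uft)).
  have W i : {m | e m (f t i) /\ e m `<=` V i}.
    apply: cid; have [C [BC Cx] CV] := Bb _ _ (nV i).
    by have [m _ mC] := @surj _ _ _ _ e _ BC; exists m; rewrite mC.
  exists [ffun i => sval (W i)] => //; split=> [i|y by_].
    by rewrite ffunE; have [] := svalP (W i).
  apply: VU => i; have [_] := svalP (W i); apply.
  by have := by_ i; rewrite ffunE.
apply: countable_bigcupT_measurable => // b.
have [bU|bU] := pselect (box b `<=` U); last first.
  by rewrite (_ : _ @^-1` _ = set0)// -subset0 => t [].
rewrite (_ : _ @^-1` _ =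
    \bigcap_(i in [set: 'I_n]) ((fun t => f t i) @^-1` e (b i))).
  apply: fin_bigcap_measurable => // i _; rewrite -[X in measurable X]setTI.
  by apply: mf => //; apply: sub_sigma_algebra; exact: Bo.
apply/seteqP; split=> t /=; first by case=> bt _ i _; exact: bt.
by move=> bt; split=> // i; exact: bt.
Qed.

Lemma measurable_coord (X : ptopologicalType) n (i : 'I_n) :
  measurable_fun setT ((fun x => x i) : borel (pow X n) -> borel X).
Proof.
apply: (@continuous_borel (pow X n) X).
exact: (@proj_continuous _ (fun=> X) i).
Qed.

Definition bounded_continuous (R : realType) (Y : topologicalType)
  (f : Y -> R) : Prop := continuous f /\ bounded_fun f.

Definition Prob (R : realType) (Y : ptopologicalType) : Type :=
  probability (borel Y) R.
HB.instance Definition _ (R : realType) (Y : ptopologicalType) :=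
  Pointed.copy (Prob R Y) (probability (borel Y) R).

Definition bc_integrals (R : realType) (Y : ptopologicalType)
    (mu : probability (borel Y) R) :
  {ptws {f : Y -> R | bounded_continuous f} -> R} :=
  fun f => \int[mu]_y sval f y.

(* Narrow topology, see [narrow_cvgP]. A measure is a function on all subsets of
   [Y], so that elements of [Prob R Y] which agree on Borel sets may differ;
   equality of measures is therefore always stated on measurable sets. *)
HB.instance Definition _ (R : realType) (Y : ptopologicalType) :=
  Topological.copy (Prob R Y) (initial_topology (@bc_integrals R Y)).

Lemma narrow_cvgP (R : realType) (Y : ptopologicalType)
    (F : set_system (Prob R Y)) (mu : Prob R Y) : Filter F ->
  F --> mu <-> forall f : Y -> R, bounded_continuous f ->
    (fun nu : Prob R Y => \int[nu]_y f y) @ F --> (\int[mu]_y f y : R).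
Proof.
move=> FF; split=> [Fmu f bf|Fmu A].
  have cI : continuous
      (fun nu : Prob R Y => @bc_integrals R Y nu (exist _ f bf)).
    move=> nu; apply: (@cvg_comp _ _ _ (@bc_integrals R Y)
        (fun g => g (exist _ f bf)) _ (nbhs (@bc_integrals R Y nu))).
      exact: (@initial_continuous (Prob R Y) _ (@bc_integrals R Y)).
    exact: (@proj_continuous {classic {f : Y -> R | bounded_continuous f}}
      (fun=> R) (exist _ f bf)).
  exact: cvg_comp Fmu (cI mu).
rewrite nbhsE /= => -[_ [[B oB <-] Bmu] BA].
suff : @bc_integrals R Y @ F --> @bc_integrals R Y mu.
  move=> /(_ B (open_nbhs_nbhs (conj oB Bmu))) FB; exact: filterS BA FB.
apply/cvg_sup => f C; rewrite nbhsE /= => -[_ [[D oD <-] Dmu] DC].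
have := Fmu _ (svalP f) D (open_nbhs_nbhs (conj oD Dmu)).
by apply: (@filterS _ F) => nu Dnu; exact: DC.
Qed.

Section signed_measures.
Context d (T : measurableType d) (R : realType).
Local Open Scope ereal_scope.

Definition csum (I : Type) (r : seq I) (nu : I -> {charge set T -> \bar R})
  (A : set T) : \bar R := \sum_(i <- r) nu i A.

Section csum.
Variables (I : Type) (r : seq I) (nu : I -> {charge set T -> \bar R}).

Let csum0 : csum r nu set0 = 0.
Proof. by rewrite /csum big1// => i _; rewrite charge0. Qed.

Let csum_fin A : measurable A -> csum r nu A \is a fin_num.
Proof.
move=> mA; rewrite /csum; elim/big_ind: _ => // [x y|i _].
  by rewrite fin_numD => -> ->.
exact: fin_num_measure.
Qed.

Let csum_additive : semi_sigma_additive (csum r nu).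
Proof.
rewrite /csum; elim: r => [|i s IH] F mF tF mUF.
  rewrite big_nil; under eq_fun do under eq_bigr do rewrite big_nil.
  by under eq_fun do rewrite big1//; exact: cvg_cst.
rewrite big_cons [X in X @ _ --> _](_ : _ = fun n =>
    \sum_(0 <= k < n) nu i (F k) +
    \sum_(0 <= k < n) \sum_(j <- s) nu j (F k)); last first.
  by apply/funext => n; under eq_bigr do rewrite big_cons; exact: big_split.
have fin_s A : measurable A -> \sum_(i <- s) nu i A \is a fin_num.
  move=> mA; elim/big_ind: _ => // [x y|j _]; last exact: fin_num_measure.
  by rewrite fin_numD => -> ->.
apply: cvgeD; last 2 first.
- exact: charge_semi_sigma_additive.
- exact: IH.
exact: fin_num_adde_defl (fin_s _ mUF).
Qed.

HB.instance Definition _ :=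
  isCharge.Build _ _ _ (csum r nu) csum0 csum_fin csum_additive.

End csum.

(* The value does not depend on the Hahn decomposition which is chosen. *)
Definition cintegral (nu : {charge set T -> \bar R}) (f : T -> R) : R :=
  let P := cid (Hahn_decomposition nu) in
  let N := cid (svalP P) in
  (\int[jordan_pos (svalP N)]_x f x - \int[jordan_neg (svalP N)]_x f x)%R.

End signed_measures.

Section charge_image.
Context d1 d2 (T1 : measurableType d1) (T2 : measurableType d2) (R : realType).

Definition cimage (nu : {charge set T1 -> \bar R}) (f : {mfun T1 >-> T2}) :
  set T2 -> \bar R := pushforward nu f.

Section cimage_charge.
Variables (nu : {charge set T1 -> \bar R}) (f : {mfun T1 >-> T2}).

Let mf A : measurable A -> measurable (f @^-1` A).
Proof.
by move=> mA; rewrite -[X in measurable X]setTI; exact: (measurable_funPT f).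
Qed.

Let cimage0 : cimage nu f set0 = 0%E.
Proof. by rewrite /cimage /pushforward preimage_set0 charge0. Qed.

Let cimage_fin A : measurable A -> cimage nu f A \is a fin_num.
Proof. by move=> /mf mA; exact: (fin_num_measure nu). Qed.

Let cimage_additive : semi_sigma_additive (cimage nu f).
Proof.
move=> F mF tF mUF; rewrite /cimage /pushforward preimage_bigcup.
apply: charge_semi_sigma_additive => [n||]; first exact: mf.
  apply/trivIsetP => /= i j _ _ ij; rewrite -preimage_setI.
  by move/trivIsetP : tF => /(_ _ _ _ _ ij) ->//; rewrite preimage_set0.
by rewrite -preimage_bigcup; exact: mf.
Qed.

HB.instance Definition _ :=
  isCharge.Build _ _ _ (cimage nu f) cimage0 cimage_fin cimage_additive.

End cimage_charge.
End charge_image.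

Definition diag (X : Type) n (x : X) : pow X n := fun=> x.

Definition permute (X : Type) n (s : {perm 'I_n}) (x : pow X n) : pow X n :=
  fun i => x (s i).

Definition restrict (X : Type) k N (kN : (k <= N)%N) (x : pow X N) : pow X k :=
  fun i => x (widen_ord kN i).

Definition concat (X : Type) m n k (mnk : (m + n)%N = k)
    (z : pow X m * pow X n) : pow X k :=
  fun i => match fintype.split (cast_ord (esym mnk) i) with
           | inl a => z.1 a
           | inr b => z.2 b
           end.

Definition mfun_of d1 d2 (T1 : measurableType d1) (T2 : measurableType d2)
    (f : T1 -> T2) (mf : measurable_fun setT f) : {mfun T1 >-> T2} :=
  HB.pack_for {mfun T1 >-> T2} f (isMeasurableFun.Build _ _ T1 T2 f mf).

Section measurable_maps.
Variables (R : realType) (X : polishType R).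

Lemma measurable_diag n :
  measurable_fun setT (@diag X n : borel X -> borel (pow X n)).
Proof. by apply: measurable_pow => i; exact: measurable_id. Qed.

Lemma measurable_permute n (s : {perm 'I_n}) :
  measurable_fun setT (@permute X n s : borel (pow X n) -> borel (pow X n)).
Proof. by apply: measurable_pow => i; exact: measurable_coord. Qed.

Lemma measurable_restrict k N (kN : (k <= N)%N) :
  measurable_fun setT (@restrict X k N kN : borel (pow X N) -> borel (pow X k)).
Proof. by apply: measurable_pow => i; exact: measurable_coord. Qed.

Lemma measurable_concat m n k (mnk : (m + n)%N = k) :
  measurable_fun setT (@concat X m n k mnk :
    borel (pow X m) * borel (pow X n) -> borel (pow X k)).
Proof.
apply: measurable_pow => i; rewrite /concat; case: fintype.split => a.
  exact: measurableT_comp (@measurable_coord _ _ a) measurable_fst.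
exact: measurableT_comp (@measurable_coord _ _ a) measurable_snd.
Qed.

End measurable_maps.

Section measures_on_powers.
Variables (R : realType) (X : polishType R).

Definition id_image n (lambda : Prob R X) : Prob R (pow X n) :=
  distribution lambda (mfun_of (@measurable_diag R X n)).

Definition tensor m n k (mnk : (m + n)%N = k)
    (mu : Prob R (pow X m)) (nu : Prob R (pow X n)) : Prob R (pow X k) :=
  distribution (mu \x nu)%E (mfun_of (@measurable_concat R X m n k mnk)).

(* [dirac point] is the only probability measure on the singleton [X^0]. *)
Fixpoint mpow (lambda : Prob R X) m : Prob R (pow X m) :=
  match m with
  | 0 => dirac point
  | m'.+1 => tensor (erefl (1 + m')%N) (id_image 1 lambda) (mpow lambda m')
  end.

Fixpoint id_tensor (lambda : Prob R X) (s : seq nat) :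
    Prob R (pow X (sumn s)) :=
  match s with
  | [::] => dirac point
  | m :: s' =>
      tensor (erefl (m + sumn s')%N) (id_image m lambda) (id_tensor lambda s')
  end.

Definition marginal k N (kN : (k <= N)%N) (gamma : Prob R (pow X N)) :
    Prob R (pow X k) :=
  distribution gamma (mfun_of (@measurable_restrict R X k N kN)).

Definition symmetrize n (nu : {charge set (borel (pow X n)) -> \bar R}) :
    {charge set (borel (pow X n)) -> \bar R} :=
  cscale (n`!%:R^-1) (csum (index_enum {perm 'I_n})
    (fun s => cimage nu (mfun_of (@measurable_permute R X n s)))).

Definition symmetric n (gamma : Prob R (pow X n)) : Prop :=
  forall A : set (borel (pow X n)), measurable A ->
    symmetrize (charge_of_finite_measure gamma) A = gamma A.

Definition representable k N (kN : (k <= N)%N) (mu : Prob R (pow X k)) : Prop :=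
  exists gamma : Prob R (pow X N), symmetric gamma /\
    forall A : set (borel (pow X k)), measurable A ->
      mu A = marginal kN gamma A.

End measures_on_powers.

Definition is_partition (j : nat) (p : seq nat) : bool :=
  [&& sorted geq p, all (leq 1) p & sumn p == j].

(* A partition of [j] has at most [j] components, all of them at most [j]. *)
Definition parts (j k : nat) : Type :=
  {p : {bseq j of 'I_j.+1} |
    is_partition j (map val p) && (j + size p <= k)%N}.

Definition part_seq j k (p : parts j k) : seq nat := map val (sval p).
Coercion part_seq : parts >-> seq.

Lemma part_seq_inj j k : injective (@part_seq j k).
Proof.
by move=> p q /(inj_map val_inj) pq; apply/val_inj/val_inj.
Qed.

Lemma part_seqP j k (p : seq nat) :
  reflect (exists q : parts j k, part_seq q = p)
    (is_partition j p && (j + size p <= k)%N).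
Proof.
apply: (iffP idP) => [|[[q qjk] <-]]; last by rewrite /part_seq size_map.
move=> /[dup] pjk /andP[/and3P[_ p0 /eqP pj] _].
have sumn_ge : forall s, all (leq 1) s ->
    (size s <= sumn s)%N && all (fun m => m <= sumn s)%N s.
  elim=> // m s IH /= /andP[m0 /IH /andP[ss sa]].
  rewrite leq_addr (leq_add m0 ss) /=; apply: sub_all sa => q qs.
  exact: leq_trans qs (leq_addl _ _).
have /andP[sp ap] := sumn_ge p p0; rewrite pj in sp ap.
have pE : map val (map (@inord j) p) = p.
  rewrite -map_comp -[RHS]map_id; apply/eq_in_map => m mp /=.
  by rewrite inordK// ltnS (allP ap).
have sq : (size (map (@inord j) p) <= j)%N by rewrite size_map.
have qjk : is_partition j (map val (Bseq sq)) && (j + size (Bseq sq) <= k)%N.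
  by rewrite /= pE size_map.
by exists (exist _ (Bseq sq) qjk).
Qed.

Lemma part_dim j k (p : parts j k) :
  (sumn [seq q.+1 | q <- p] + (k - j - size p))%N = k.
Proof.
have /andP[/and3P[_ _ /eqP pj] jk] : is_partition j p && (j + size p <= k)%N.
  by apply/part_seqP; exists p.
have : sumn [seq q.+1 | q <- p] = (sumn p + size p)%N.
  by elim: (part_seq p) => //= q s ->; rewrite addSn addnS addnA.
by rewrite pj => ->; rewrite -subnDA subnKC.
Qed.

Section FNk.
Variables (R : realType) (X : polishType R).

Definition part_coef k j (p : parts j k) : R :=
  k`!%:R / (k - j - size p)`!%:R
  * \prod_(q <- p) (q.+1)%:R^-1
  * \prod_(q <- undup p) (count_mem q p)`!%:R^-1.

Definition part_measure k j (p : parts j k) (lambda : Prob R X) :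
    Prob R (pow X k) :=
  tensor (part_dim p) (id_tensor lambda [seq q.+1 | q <- p])
    (mpow lambda (k - j - size p)).

Definition Pjk k j (lambda : Prob R X) :
    {charge set (borel (pow X k)) -> \bar R} :=
  csum (index_enum (parts j k))
    (fun p => cscale (part_coef p)
      (charge_of_finite_measure (part_measure p lambda))).

Definition FNk N k (lambda : Prob R X) :
    {charge set (borel (pow X k)) -> \bar R} :=
  cscale (N%:R ^+ k.-1 / \prod_(1 <= i < k) (N%:R - i%:R))
    (cadd (charge_of_finite_measure (mpow lambda k))
      (csum (index_iota 1 k)
        (fun j => cscale ((-1) ^+ j / N%:R ^+ j)
          (symmetrize (Pjk k j lambda))))).

End FNk.

Section representation.
Variables (R : realType) (X : polishType R).

Definition empirical N : set (Prob R X) :=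
  [set lambda : Prob R X | exists x : 'I_N -> X,
    forall A : set (borel X), measurable A ->
    lambda A = ((N%:R^-1)%:E * \sum_(i < N) \d_(x i : borel X) A)%E].

Definition represents N k (alpha : Prob R (Prob R X)) (mu : Prob R (pow X k)) :
    Prop :=
  alpha (empirical N) = 1%E /\
  forall phi : pow X k -> R, bounded_continuous phi ->
    \int[mu]_x phi x =
    \int[alpha]_(lambda in empirical N) cintegral (FNk N k lambda) phi.

End representation.

(* Main.v *)
Require Import Defs.
From mathcomp Require Import all_boot all_order all_algebra perm.
From mathcomp Require Import ring lra zify.
From mathcomp Require Import all_classical all_reals all_analysis.
From mathcomp Require Import measurable_realfun giry.
Import Order.TTheory GRing.Theory Num.Theory.
Import numFieldNormedType.Exports.

Set Implicit Arguments.
Unset Strict Implicit.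
Unset Printing Implicit Defensive.

Local Open Scope classical_set_scope.
Local Open Scope ring_scope.

(** Let [lambda] be the empirical measure of [x_1, ..., x_N]. Expanding the
products of [lambda] and of its diagonal images, [F_{N,k}(lambda)] becomes
[(N - k)! / N!] times the sum over cycle types of permutations of [k] letters,
weighted with signs and sizes of conjugacy classes, of the sums of Dirac masses
at the points [x o f], where [f] is constant on cycles. The sum of the signs of
the permutations which fix a given [f] vanishes unless [f] is injective, so
that [F_{N,k}(lambda)] is the law of a sample of size [k], without replacement,
from [x_1, ..., x_N]. The cancellation is obtained from a recursion of Newton
type which the sums over partitions and the sums over injections both satisfy.

Given [alpha], the mixture [gamma] of the laws [F_{N,N}(lambda)] is symmetric
and its [k]-point marginal is the mixture of the laws [F_{N,k}(lambda)].
Conversely, [alpha] is taken to be the image of [gamma] under the map which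
sends [x] to its empirical measure; it is recovered from [gamma] in
this way, whence uniqueness for [k = N]. The map
[lambda |-> F_{N,k}(lambda)(A)] is Borel because [F_{N,k}] is a polynomial in
[lambda], and the set of empirical measures is Borel because a probability
measure with values in [(1/N) Z] on the finite unions of a countable base is
empirical. *)

(** * Sums over injective sequences and over partitions *)

Section symmetric_sums.
Variables (R : numFieldType) (T : finType).
Implicit Types (H : seq T -> R) (s t u : seq T) (p q : seq nat).

Definition perm_invariant r H :=
  forall s t, size s = r -> perm_eq s t -> H s = H t.

Lemma perm_invariant_cat H m r s :
  size s = m -> perm_invariant (m + r) H ->
  perm_invariant r (fun t => H (s ++ t)).
Proof.
move=> sm Hs t u tr tu.
by apply: Hs; rewrite ?perm_cat2l// size_cat sm tr.
Qed.

Fixpoint injseqs r : seq (seq T) :=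
  if r is r'.+1 then
    [seq y :: u | u <- injseqs r', y <- [seq y <- enum T | y \notin u]]
  else [:: [::]].

Lemma mem_injseqs r t : (t \in injseqs r) = uniq t && (size t == r).
Proof.
elim: r t => [|r IH] t; first by rewrite inE; case: t => //= a t; rewrite andbF.
apply/allpairsPdep/idP => [[u [y [+ + ->]]]|].
  by rewrite IH mem_filter => /andP[ut su] /andP[yu _] /=; rewrite yu ut.
case: t => [|y u]; first by rewrite andbF.
move=> /= /andP[/andP[yu uu] su].
by exists u, y; rewrite IH uu -eqSS su mem_filter yu mem_enum.
Qed.

Lemma injseqs_uniq r : uniq (injseqs r).
Proof.
elim: r => //= r IH; apply: allpairs_uniq_dep => // [u _|].
  by rewrite filter_uniq ?enum_uniq.
by move=> [u y] [v z] _ _ /= [-> ->].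
Qed.

Lemma big_injseqsS r H : \sum_(t <- injseqs r.+1) H t =
  \sum_(u <- injseqs r) \sum_(y | y \notin u) H (y :: u).
Proof.
rewrite big_allpairs_dep; apply: eq_bigr => u _.
by rewrite big_filter big_enum_cond.
Qed.

(** Double counting: an entry of an injective sequence sits in one of [r.+1] positions, and
    invariance lets it be moved to the front. The induction separates the head of the sequence from
    the other entries. *)
Lemma sum_injseqs_mem r (G : T -> seq T -> R) :
  (forall y, perm_invariant r.+1 (G y)) ->
  \sum_(u <- injseqs r.+1) \sum_(y in u) G y u =
  r.+1%:R * \sum_(u <- injseqs r) \sum_(y | y \notin u) G y (y :: u).
Proof.
have sum_cons y u (F : T -> R) : y \notin u ->
    \sum_(z in y :: u) F z = F y + \sum_(z in u) F z.
  move=> yu; rewrite (bigD1 y) ?mem_head//=; congr (_ + _).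
  apply: eq_bigl => z; rewrite inE; have [->|] := eqVneq z y => //=.
    by rewrite (negbTE yu).
  by rewrite andbT.
elim: r G => [|r IH] G Gs.
  rewrite big_injseqsS mul1r /= !big_seq1; apply: eq_bigr => y _.
  by rewrite sum_cons// [X in _ + X]big1 ?addr0// => z; rewrite inE.
rewrite big_injseqsS.
under eq_bigr => u _ do under eq_bigr => y yu do rewrite sum_cons//.
under eq_bigr => u _ do rewrite big_split /=.
rewrite big_split /= -[r.+2]add1n natrD mulrDl mul1r; congr (_ + _).
under eq_bigr => u _ do rewrite exchange_big/=.
rewrite (IH (fun z u => \sum_(y | y \notin u) G z (y :: u))); last first.
  move=> z s t ss st; under eq_bigl do rewrite (perm_mem st).
  by apply: eq_bigr => y _; apply: Gs; rewrite /= ?ss// perm_cons.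
congr (_ * _); rewrite big_injseqsS [LHS]big_seq [RHS]big_seq.
apply: eq_bigr => u; rewrite mem_injseqs => /andP[_ /eqP su].
rewrite (exchange_big_dep (fun y => y \notin u))/=; last first.
  by move=> z y _; rewrite inE negb_or => /andP[].
apply: eq_bigr => y yu; apply: eq_big => [z|z].
  by rewrite !inE !negb_or yu andbT eq_sym andbC.
move=> _; apply: Gs; first by rewrite /= su.
by apply/permPl; exact: (perm_catCA [:: y] [:: z] u).
Qed.

Let J H r i := \sum_(u <- injseqs r) \sum_y H (nseq i y ++ u).
Let K H r i := \sum_(u <- injseqs r) \sum_(y | y \notin u) H (nseq i y ++ u).

(** A free letter [y] either avoids [u] or is one of its [r.+1] entries; in the second case it
    leaves [u] and joins the block, whose length grows by one. *)
Let JS H r i : perm_invariant (i + r.+1) H ->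
  J H r.+1 i = K H r.+1 i + r.+1%:R * K H r i.+1.
Proof.
move=> Hs; rewrite /J.
under eq_bigr => u _ do rewrite (bigID (fun y => y \notin u)) /=.
rewrite big_split /=; congr (_ + _).
under eq_bigr => u _ do under eq_bigl do rewrite negbK.
rewrite (@sum_injseqs_mem r (fun y u => H (nseq i y ++ u))); last first.
  by move=> y; apply: perm_invariant_cat Hs; rewrite size_nseq.
congr (_ * _); rewrite /K [LHS]big_seq [RHS]big_seq.
apply: eq_bigr => u; rewrite mem_injseqs => /andP[_ /eqP su].
apply: eq_bigr => y _; apply: Hs; first by rewrite size_cat size_nseq /= su.
by apply/permPl; exact: (perm_catCA (nseq i y) [:: y] u).
Qed.

(** [JS] is solved for [K H r.+1 i] and iterated: each step shortens [u] by one, changes the sign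
    and contributes one factor of the falling factorial. *)
Let KE H r i : perm_invariant (i + r) H ->
  K H r i = \sum_(a < r.+1)
    (-1) ^+ a * (r`!%:R / (r - a)`!%:R) * J H (r - a) (i + a).
Proof.
elim: r i => [|r IH] i Hs.
  rewrite big_ord1 expr0 divff ?mulr1 ?mul1r// ?pnatr_eq0 -?lt0n ?fact_gt0//.
  by rewrite addn0 /J /K /= !big_seq1; apply: eq_bigl => y.
rewrite -[K H r.+1 i](addrK (r.+1%:R * K H r i.+1)) -(JS Hs).
rewrite IH; last by rewrite addSnnS.
rewrite [RHS]big_ord_recl /= expr0 subn0 addn0 divff ?mulr1 ?mul1r; last first.
  by rewrite pnatr_eq0 -?lt0n ?fact_gt0.
congr (_ + _); rewrite mulr_sumr -sumrN; apply: eq_bigr => a _.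
rewrite subSS addSnnS /bump /= add1n exprS factS natrM.
by rewrite !mulNr mul1r !mulrA [_.+1%:R * (-1) ^+ _]mulrC.
Qed.

(** The head of an injective sequence is a block of length one, so this is [KE] at [i = 1]. For [H]
    a product over the letters it is Newton's identity between elementary symmetric functions and
    power sums. *)
Lemma injseqs_newton H k : perm_invariant k.+1 H ->
  \sum_(t <- injseqs k.+1) H t = \sum_(a < k.+1)
    (-1) ^+ a * (k`!%:R / (k - a)`!%:R) *
    \sum_y \sum_(u <- injseqs (k - a)) H (nseq a.+1 y ++ u).
Proof.
move=> Hs; rewrite big_injseqsS.
have := @KE H k 1; rewrite add1n => /(_ Hs); rewrite /K /= => ->.
by apply: eq_bigr => a _; rewrite /J exchange_big.
Qed.

(** Different blocks may carry the same letter. Averages over this list are integrals against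
    products of diagonal images of an empirical measure. *)
Fixpoint blockseqs p : seq (seq T) :=
  if p is m :: p' then
    [seq nseq m y ++ t | y <- enum T, t <- blockseqs p']
  else [:: [::]].

Lemma big_blockseqs_cons m p H : \sum_(t <- blockseqs (m :: p)) H t =
  \sum_y \sum_(t <- blockseqs p) H (nseq m y ++ t).
Proof. by rewrite big_allpairs_dep big_enum. Qed.

Lemma size_blockseqs p t : t \in blockseqs p -> size t = sumn p.
Proof.
elim: p t => [|m p IH] t /=; first by rewrite inE => /eqP ->.
by case/allpairsP => -[y u] [_ /IH su ->] /=; rewrite size_cat size_nseq su.
Qed.

Lemma big_blockseqs_cat p q H : \sum_(t <- blockseqs (p ++ q)) H t =
  \sum_(t <- blockseqs p) \sum_(u <- blockseqs q) H (t ++ u).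
Proof.
elim: p H => [|m p IH] H; first by rewrite big_seq1.
rewrite !big_blockseqs_cons; apply: eq_bigr => y _; rewrite IH.
by apply: eq_bigr => t _; apply: eq_bigr => u _; rewrite catA.
Qed.

Lemma big_blockseqs_perm p q H : perm_invariant (sumn p) H -> perm_eq p q ->
  \sum_(t <- blockseqs p) H t = \sum_(t <- blockseqs q) H t.
Proof.
elim: p q H => [|m p IH] q H Hs pq.
  by move: pq; rewrite perm_sym => /perm_nilP ->.
have mq : m \in q by rewrite -(perm_mem pq) mem_head.
case/splitPr: mq pq Hs => q1 q2 pq Hs.
have {pq}pq : perm_eq p (q1 ++ q2).
  by rewrite -(perm_cons m) (permPl pq) -cat1s perm_catCA.
rewrite big_blockseqs_cons big_blockseqs_cat.
under [RHS]eq_bigr do rewrite big_blockseqs_cons.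
rewrite [RHS]exchange_big; apply: eq_bigr => y _ /=.
rewrite (IH (q1 ++ q2))//; last first.
  by apply: perm_invariant_cat Hs; rewrite size_nseq.
rewrite big_blockseqs_cat [LHS]big_seq [RHS]big_seq; apply: eq_bigr => t tq.
rewrite [LHS]big_seq [RHS]big_seq; apply: eq_bigr => u uq.
apply: Hs; last by rewrite perm_catCA.
rewrite !size_cat size_nseq (size_blockseqs tq) (size_blockseqs uq) /=.
by rewrite -sumn_cat (perm_sumn pq).
Qed.

End symmetric_sums.
(* The order of the centralizer in the symmetric group of a permutation with
   cycle lengths [p]. *)
Fixpoint zpart (p : seq nat) : nat :=
  if p is i :: p' then i * (count_mem i p').+1 * zpart p' else 1.

(** Prepending [i] contributes the factor [i] and turns the factorial of the multiplicity of [i]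
    into the next one. *)
Lemma zpartE p :
  zpart p = (\prod_(i <- p) i * \prod_(i <- undup p) (count_mem i p)`!)%N.
Proof.
elim: p => [|i p /= ->]; first by rewrite !big_nil.
rewrite big_cons.
suff -> : (\prod_(j <- undup (i :: p)) (count_mem j (i :: p))`! =
    (count_mem i p).+1 * \prod_(j <- undup p) (count_mem j p)`!)%N.
  rewrite !mulnA; congr (_ * _)%N; rewrite -!mulnA; congr (_ * _)%N.
  exact: mulnC.
have prodE s : i \notin s -> (\prod_(j <- s) (count_mem j (i :: p))`! =
    \prod_(j <- s) (count_mem j p)`!)%N.
  move=> si; rewrite big_seq [RHS]big_seq; apply: eq_bigr => j js.
  rewrite /=; have [ij|] := eqVneq i j; last by rewrite add0n.
  by rewrite ij js in si.
rewrite [undup (i :: p)]/=; case: ifPn => ip; last first.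
  rewrite big_cons prodE ?mem_undup//= eqxx (count_memPn ip).
  by [].
have iu : i \in undup p by rewrite mem_undup.
rewrite (perm_big _ (perm_to_rem iu))/= [in RHS](perm_big _ (perm_to_rem iu))/=.
rewrite !big_cons /= eqxx add1n factS -mulnA prodE//.
by rewrite mem_rem_uniqF// undup_uniq.
Qed.

Lemma perm_zpart p q : perm_eq p q -> zpart p = zpart q.
Proof.
move=> pq; rewrite !zpartE (perm_big _ pq)/=; congr (_ * _)%N.
rewrite (perm_big _ (perm_undup (perm_mem pq)))/=.
by apply: eq_bigr => i _; rewrite (seq.permP pq).
Qed.

Lemma zpart_gt0 p : all (leq 1) p -> (0 < zpart p)%N.
Proof. by elim: p => //= i p IH /andP[i0 /IH]; rewrite !muln_gt0 i0. Qed.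

Lemma sumn_undup_count p : (\sum_(i <- undup p) i * count_mem i p)%N = sumn p.
Proof.
rewrite sumnE -[RHS](big_undup_iterop_count _ _ xpredT) /=.
by apply: eq_bigr => i _; rewrite Monoid.iteropE iter_addn_0 mulnC.
Qed.

Lemma size_le_sumn p : all (leq 1) p -> (size p <= sumn p)%N.
Proof. by elim: p => //= i p IH /andP[i0 /IH]; exact: (leq_add i0). Qed.

(** * Partitions and the removal of an entry *)

Lemma partsP j k (p : parts j k) :
  [/\ sorted geq p, all (leq 1) p, sumn p = j & (j + size p <= k)%N].
Proof.
have /part_seqP/andP[/and3P[? ? /eqP] ?] :
  exists q : parts j k, part_seq q = p by exists p.
by [].
Qed.

(** A partition of [k] has at most [k] entries, so the bound [k + k] admits all of them. *)
Definition partitions k : seq (seq nat) :=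
  [seq part_seq p | p <- index_enum (parts k (k + k))].

Lemma mem_partitions k p : (p \in partitions k) = is_partition k p.
Proof.
apply/mapP/idP => [[q _ ->]|pk].
  by have [sq q0 qk _] := partsP q; apply/and3P; split=> //; apply/eqP.
have : is_partition k p && (k + size p <= k + k)%N.
  have /and3P[_ ap /eqP pE] := pk.
  by rewrite pk leq_add2l -pE size_le_sumn.
by move=> /part_seqP[q <-]; exists q => //; rewrite mem_index_enum.
Qed.

Lemma partitions_uniq k : uniq (partitions k).
Proof. by rewrite map_inj_uniq ?index_enum_uniq//; exact: part_seq_inj. Qed.

Lemma is_partition_rem k i p : is_partition k p -> i \in p ->
  [/\ (0 < i <= k)%N & is_partition (k - i) (rem i p)].
Proof.
case/and3P=> sp ap /eqP <- ip.
have pE := perm_to_rem ip; have sE := perm_sumn pE; split.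
  by rewrite (allP ap)//= sE leq_addr.
apply/and3P; split.
- apply: subseq_sorted sp; last exact: rem_subseq.
  by move=> a b c ab bc; exact: leq_trans bc ab.
- by apply/allP => j /mem_rem/(allP ap).
- by rewrite sE /= addKn.
Qed.

Lemma is_partition_perm k l p q :
  is_partition k p -> is_partition l q -> perm_eq p q -> p = q.
Proof.
move=> /and3P[sp _ _] /and3P[sq _ _]; apply: (sorted_eq _ _ sp sq).
  by move=> a b c ab bc; exact: leq_trans bc ab.
by move=> a b; rewrite andbC; exact: anti_leq.
Qed.

(** Removing one entry is a bijection from the pairs of a partition and one of its distinct entries
    [i] to the pairs of [i] and a partition of [k - i]; the inverse inserts [i] and sorts. *)
Lemma big_partitions_rem (R : numFieldType) k (F : nat -> seq nat -> R) :
  \sum_(p <- partitions k) \sum_(i <- undup p) F i (rem i p) =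
  \sum_(i <- iota 1 k) \sum_(q <- partitions (k - i)) F i q.
Proof.
pose G (x : nat * seq nat) := F x.1 x.2.
transitivity (\sum_(x <- [seq (i, rem i p) | p <- partitions k, i <- undup p])
    G x).
  by rewrite big_allpairs_dep.
transitivity (\sum_(x <- [seq (i, q) | i <- iota 1 k, q <- partitions (k - i)])
    G x); last by rewrite big_allpairs_dep.
apply: perm_big; apply: uniq_perm.
- apply: allpairs_uniq_dep => [|p _|].
    exact: partitions_uniq.
    exact: undup_uniq.
  move=> _ _ /allpairsPdep[p [i [pk ip ->]]] /allpairsPdep[q [j [qk jq ->]]].
  move: ip jq; rewrite !mem_undup => ip jq [/= ij rpq]; subst j.
  rewrite !mem_partitions in pk qk.
  suff -> : p = q by [].
  apply: is_partition_perm pk qk _; rewrite (permPl (perm_to_rem ip)).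
  by rewrite perm_sym (permPl (perm_to_rem jq)) rpq.
- apply: allpairs_uniq_dep => [|i _|].
    exact: iota_uniq.
    exact: partitions_uniq.
  by move=> [i p] [j q] _ _ /= [-> ->].
move=> x; apply/allpairsPdep/allpairsPdep => [[p [i [+ + ->]]]|].
  rewrite mem_partitions mem_undup => pk /(is_partition_rem pk)[ik rk].
  by exists i, (rem i p); rewrite mem_iota add1n ltnS mem_partitions.
case=> i [q [+ + ->]]; rewrite mem_iota add1n ltnS mem_partitions => ik qk.
have /and3P[sq aq /eqP qE] := qk; have /andP[i0 ile] := ik.
have pk : is_partition k (sort geq (i :: q)).
  apply/and3P; split.
  - by apply: sort_sorted => a b; exact: leq_total.
  - by rewrite all_sort /= i0.
  - by rewrite (perm_sumn (permEl (perm_sort _ _))) /= qE subnKC.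
have ip : i \in sort geq (i :: q) by rewrite mem_sort mem_head.
have [_ rk] := is_partition_rem pk ip.
exists (sort geq (i :: q)), i; rewrite mem_partitions mem_undup; split=> //.
congr (_, _); apply: is_partition_perm qk rk _.
rewrite -(perm_cons i) -(permPr (perm_to_rem ip)) perm_sym.
exact: permEl (perm_sort _ _).
Qed.

(** * The signed sum over cycle types *)

Section signed_partition_sum.
Variables (R : numFieldType) (T : finType).
Implicit Types H : seq T -> R.

Let W k H := \sum_(p <- partitions k)
  (-1) ^+ (k - size p) * (k`!%:R / (zpart p)%:R) *
    \sum_(t <- blockseqs T p) H t.

(** The signed sum obeys the recursion of [injseqs_newton], obtained by removing one entry from each
    partition. *)
Let WS k H : perm_invariant k.+1 H -> W k.+1 H = \sum_(a < k.+1)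
  (-1) ^+ a * (k`!%:R / (k - a)`!%:R) *
  \sum_y W (k - a) (fun t => H (nseq a.+1 y ++ t)).
Proof.
move=> Hs; have k0 : k.+1%:R != 0 :> R by rewrite pnatr_eq0.
(* [k.+1] is the sum of [i * count_mem i p] over the distinct entries [i] of [p], and this product
   is the quotient of [zpart p] by [zpart (rem i p)]. *)
apply: (mulfI k0).
pose F i q : R := (-1) ^+ (k - size q) * (k.+1`!%:R / (zpart q)%:R) *
  \sum_(t <- blockseqs T (i :: q)) H t.
transitivity (\sum_(p <- partitions k.+1) \sum_(i <- undup p) F i (rem i p)).
  rewrite mulr_sumr big_seq [RHS]big_seq; apply: eq_bigr => p.
  rewrite mem_partitions => pk; have /and3P[_ ap /eqP sp] := pk.
  rewrite -{1}sp -sumn_undup_count natr_sum mulr_suml.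
  rewrite [LHS]big_seq [RHS]big_seq; apply: eq_bigr => i.
  rewrite mem_undup => ip.
  have pE := perm_to_rem ip.
  rewrite /F -(big_blockseqs_perm _ pE); last by rewrite sp.
  rewrite (perm_zpart pE) /= (perm_size pE) /= subSS.
  have [ik /and3P[_ ar _]] := is_partition_rem pk ip.
  rewrite !mulrA; congr (_ * _).
  rewrite (seq.permP pE) /= eqxx add1n !natrM.
  have z0 : (zpart (rem i p))%:R != 0 :> R by rewrite pnatr_eq0 -lt0n zpart_gt0.
  have i0 : i%:R != 0 :> R by rewrite pnatr_eq0 -lt0n; case/andP: ik.
  have c0 : (count_mem i (rem i p)).+1%:R != 0 :> R by rewrite pnatr_eq0.
  by field; rewrite z0 i0 -natr1 addrC in c0 *; rewrite c0.
rewrite (big_partitions_rem k.+1 F) -{1}[1%N]addn0 iotaDl big_map.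
rewrite -[X in iota _ X]subn0 -/(index_iota _ _) big_mkord mulr_sumr.
apply: eq_bigr => a _; rewrite add1n subSS.
rewrite exchange_big /= !mulr_sumr big_seq [RHS]big_seq; apply: eq_bigr => q.
rewrite mem_partitions => /and3P[_ aq /eqP sq].
rewrite /F big_blockseqs_cons mulr_sumr !mulr_sumr; apply: eq_bigr => y _.
rewrite !mulrA; congr (_ * _).
have qa : (size q <= k - a)%N by rewrite -sq size_le_sumn.
(* The sign splits because [k - size q] is [a] plus [k - a - size q], where [q] has at most [k - a]
   entries. *)
rewrite factS natrM -[k in LHS](subnKC (ltnSE (ltn_ord a))) -addnBA// exprD.
have f0 : (k - a)`!%:R != 0 :> R by rewrite pnatr_eq0 -lt0n fact_gt0.
have z0 : (zpart q)%:R != 0 :> R by rewrite pnatr_eq0 -lt0n zpart_gt0.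
rewrite subnKC ?(ltnSE (ltn_ord a))//.
by field; rewrite f0 z0.
Qed.

(** The coefficient is the sign of a cycle type times the size of its conjugacy class. Both sides
    agree for [k = 0] and satisfy the same recursion, by [WS] and [injseqs_newton]. *)
Lemma sum_partitions_injseqs k H : perm_invariant k H ->
  \sum_(p <- partitions k) (-1) ^+ (k - size p) * (k`!%:R / (zpart p)%:R) *
    \sum_(t <- blockseqs T p) H t =
  \sum_(t <- injseqs T k) H t.
Proof.
rewrite -/(W k H); elim/ltn_ind: k H => -[|k] IH H Hs.
  have -> : W 0 H = H [::].
    have p0 : perm_eq (partitions 0) [:: [::]].
      apply: uniq_perm => [||p]; [exact: partitions_uniq|by []|].
      rewrite mem_partitions inE; case: p => //= i p.
      rewrite /is_partition /= addn_eq0 andbC.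
      by case: i => //=; rewrite andbF.
    rewrite /W (perm_big _ p0) big_seq1 /= big_seq1 expr0.
    by rewrite divff ?mul1r ?pnatr_eq0.
  by rewrite big_seq1.
rewrite WS// injseqs_newton//; apply: eq_bigr => a _; congr (_ * _).
apply: eq_bigr => y _; apply: IH; first by rewrite ltnS leq_subr.
apply: perm_invariant_cat; first exact: size_nseq.
by rewrite addSn subnKC// -ltnS.
Qed.

End signed_partition_sum.

(* The cycle type in the symmetric group on [k] letters which corresponds to
   [p], where [q] stands for a cycle of length [q + 1]. *)
Definition cycle_type k j (p : seq nat) : seq nat :=
  [seq q.+1 | q <- p] ++ nseq (k - j - size p) 1%N.

Lemma size_cycle_type k j (p : parts j k) : size (cycle_type k j p) = (k - j)%N.
Proof.
rewrite size_cat size_map size_nseq subnKC//.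
by have [_ _ _ jk] := partsP p; lia.
Qed.

Lemma sumn_map_succ p : sumn [seq q.+1 | q <- p] = (sumn p + size p)%N.
Proof. by elim: p => //= q p ->; rewrite addSn addnS addnA. Qed.

Lemma cycle_type_partition k j (p : parts j k) :
  is_partition k (cycle_type k j p).
Proof.
have [sp _ pj jk] := partsP p.
apply/and3P; split.
- rewrite sorted_pairwise; last by move=> a b c ab bc; exact: leq_trans bc ab.
  rewrite /cycle_type pairwise_cat; apply/and3P; split.
  + apply/allrelP => x y /mapP[z _ ->]; rewrite mem_nseq => /andP[_ /eqP ->].
    by [].
  + rewrite pairwise_map -sorted_pairwise//.
    by move=> a b c ab bc; exact: leq_trans bc ab.
  + by elim: (k - j - size p)%N => //= n ->; rewrite andbT all_nseq orbT.
- by rewrite all_cat all_map all_nseq orbT andbT; apply/allP.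
- by rewrite sumn_cat sumn_map_succ sumn_nseq pj mul1n -subnDA subnKC.
Qed.

(** The coefficient is the size of a conjugacy class: the entries [q.+1] are at least two, so that
    the trailing ones form a separate multiplicity class and produce the factorial of
    [k - j - size p]. *)
Lemma zpart_cycle_type (R : realType) k j (p : parts j k) :
  k`!%:R / (zpart (cycle_type k j p))%:R = part_coef R p.
Proof.
have [_ p0 _ _] := partsP p.
rewrite /part_coef zpartE /cycle_type; set r := (k - j - size p)%N.
rewrite !prodfV -!natr_prod big_cat /= big_map.
rewrite [\prod_(i <- nseq _ _) _]big1_seq ?muln1; last first.
  by move=> i /andP[_]; rewrite mem_nseq => /andP[_ /eqP].
have E : (\prod_(i <- undup ([seq q.+1 | q <- p] ++ nseq r 1))
    (count_mem i ([seq q.+1 | q <- p] ++ nseq r 1))`! =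
    r`! * \prod_(q <- undup p) (count_mem q p)`!)%N.
  have -> : (\prod_(q <- undup p) (count_mem q p)`! = \prod_(i <-
      undup [seq q.+1 | q <- p]) (count_mem i [seq q.+1 | q <- p])`!)%N.
    rewrite (undup_map_inj succn_inj).
    rewrite big_map; apply: eq_bigr => q _; rewrite [in RHS]count_map.
    by rewrite (@eq_count _ (preim succn (pred1 q.+1)) (pred1 q)).
  have n1 : 1%N \notin [seq q.+1 | q <- p].
    by apply/mapP => -[[//|q]] /(allP p0).
  have [->|r0] := posnP r; first by rewrite cats0 mul1n.
  have pu : perm_eq (undup ([seq q.+1 | q <- p] ++ nseq r 1))
      (1%N :: undup [seq q.+1 | q <- p]).
    apply: uniq_perm; rewrite ?undup_uniq//= ?undup_uniq ?mem_undup ?n1//.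
    move=> i; rewrite inE !mem_undup mem_cat mem_nseq r0 /= orbC.
    by [].
  rewrite (perm_big _ pu) big_cons /= count_cat (count_memPn n1) add0n.
  rewrite count_nseq /= mul1n; congr (_ * _)%N.
  rewrite big_seq [RHS]big_seq; apply: eq_bigr => i; rewrite mem_undup => iu.
  rewrite count_cat count_nseq /=; case: eqP => [i1|]; last by rewrite addn0.
  by rewrite i1 in n1; rewrite iu in n1.
by rewrite E !natrM !invfM -!mulrA; congr (_ * _); rewrite mulrCA.
Qed.

(** A partition of [k] determines [j], which is [k] minus the number of its entries, and [p], which
    is recovered by dropping the ones and lowering the other entries by one. *)
Lemma big_partitions_cycle_type (R : numFieldType) k (F : seq nat -> R) :
  (0 < k)%N -> \sum_(p <- partitions k) F p =
  \sum_(0 <= j < k) \sum_(p : parts j k) F (cycle_type k j p).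
Proof.
move=> k0.
pose L := allpairs_dep (fun j (p : parts j k) => cycle_type k j p)
  (index_iota 0 k) (fun j => index_enum (parts j k)).
transitivity (\sum_(x <- L) F x); last by rewrite big_allpairs_dep.
apply: perm_big; apply: uniq_perm; first exact: partitions_uniq.
  apply: allpairs_uniq_dep => [|j _|].
  - exact: iota_uniq.
  - exact: index_enum_uniq.
  - move=> _ _ /allpairsPdep[j [p [+ _ ->]]] /allpairsPdep[j' [p' [+ _ ->]]].
    rewrite !mem_index_iota /= => jk jk' pp'.
    have jj' : j = j'.
      have := congr1 size pp'; rewrite !size_cycle_type.
      by move: jk jk'; lia.
    subst j'; congr existT; apply: part_seq_inj.
    have pE (q : seq nat) : all (leq 1) q ->
        [seq i.-1 | i <- cycle_type k j q & (1 < i)%N] = q.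
      move=> q0; rewrite filter_cat [X in _ ++ X]filter_nseq /= cats0.
      rewrite filter_map -map_comp (eq_filter (a2 := leq 1))//.
      by rewrite (all_filterP q0) map_id.
    have [_ p0 _ _] := partsP p; have [_ p'0 _ _] := partsP p'.
    by rewrite -[LHS]pE// pp' pE.
move=> q; rewrite mem_partitions; apply/idP/allpairsPdep; last first.
  by move=> [j [p [_ _ ->]]]; exact: cycle_type_partition.
move=> /and3P[sq q0 /eqP qk].
pose p := [seq i.-1 | i <- q & (1 < i)%N].
(* As [q] is nonincreasing, its ones come last. *)
have qE : q = [seq i.+1 | i <- p] ++ nseq (count_mem 1%N q) 1%N.
  rewrite /p -map_comp {qk p}; elim: q sq q0 => //= i q IH iq /andP[i0 q0].
  have sq := path_sorted iq; rewrite {1}(IH sq q0).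
  case: i i0 iq => // -[|i] _ iq /=; last by rewrite add0n.
  have -> : [seq i <- q | (1 < i)%N] = [::].
    apply/eqP; rewrite -size_eq0 size_filter -leqn0 leqNgt -has_count.
    apply/hasPn => x xq; rewrite -leqNgt.
    have tr : transitive geq by move=> a b c ab bc; exact: leq_trans bc ab.
    by have /allP/(_ _ xq) := order_path_min tr iq.
  by [].
have sp := congr1 sumn qE.
rewrite sumn_cat sumn_map_succ sumn_nseq mul1n qk in sp.
have p0 : all (leq 1) p.
  by apply/allP => i /mapP[[|[|m]]]; rewrite mem_filter //= => _ ->.
have tr : transitive geq by move=> a b c ab bc; exact: leq_trans bc ab.
have pk : is_partition (sumn p) p && (sumn p + size p <= k)%N.
  apply/andP; split; last by rewrite sp leq_addr.
  apply/and3P; split=> //; apply: (@homo_sorted _ _ _ geq).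
    by move=> a b /= ba; rewrite -!subn1 leq_sub2r.
  exact: sorted_filter.
have /part_seqP[r rp] := pk.
have jk : (sumn p < k)%N.
  have [/size0nil pnil|] := posnP (size p); last by move: sp; lia.
  by rewrite pnil.
exists (sumn p), r; rewrite mem_index_iota mem_index_enum; split=> //.
rewrite /cycle_type rp [LHS]qE; congr (_ ++ nseq _ _).
by rewrite [X in (X - _ - _)%N]sp -addnA addKn addKn.
Qed.

(** * Permutations of the positions in a sequence *)

Section permuted_sequences.
Variables (R : numFieldType) (T : finType) (x0 : T) (k : nat).
Implicit Types (F : seq T -> R) (t : seq T) (s : {perm 'I_k}).

Definition permute_seq s t : seq T := [seq nth x0 t (s i) | i <- enum 'I_k].

Lemma size_permute_seq s t : size (permute_seq s t) = k.
Proof. by rewrite size_map size_enum_ord. Qed.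

Lemma nth_permute_seq s t (i : 'I_k) :
  nth x0 (permute_seq s t) i = nth x0 t (s i).
Proof. by rewrite (nth_map i) ?size_enum_ord// nth_ord_enum. Qed.

Lemma permute_seqM s s' t :
  permute_seq s (permute_seq s' t) = permute_seq (s * s') t.
Proof.
by apply: eq_map => i; rewrite nth_permute_seq permM.
Qed.

Lemma permute_seq1 t : size t = k -> permute_seq 1 t = t.
Proof.
move=> tk; apply: (@eq_from_nth _ x0); first by rewrite size_permute_seq tk.
rewrite size_permute_seq => i ik.
by rewrite (nth_permute_seq 1 t (Ordinal ik)) perm1.
Qed.

Lemma perm_permute_seq s t : size t = k -> perm_eq (permute_seq s t) t.
Proof.
move=> tk; rewrite -[X in perm_eq _ X](permute_seq1 tk).
have -> : permute_seq 1 t = [seq nth x0 t i | i : 'I_k <- enum 'I_k].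
  by apply: eq_map => i; rewrite perm1.
rewrite /permute_seq (map_comp (fun i : 'I_k => nth x0 t i)) perm_map//.
apply: uniq_perm; rewrite ?enum_uniq//.
  by rewrite map_inj_uniq ?enum_uniq//; exact: perm_inj.
move=> i; rewrite mem_enum; apply/mapP; exists (s^-1 i)%g.
  by rewrite mem_enum.
by rewrite permKV.
Qed.

(** The symmetrization operator, transposed from measures to test functions. *)
Definition symmetrized F t : R := k`!%:R^-1 * \sum_s F (permute_seq s t).

Section perm_closed_list.
Variable L : seq (seq T).
Hypotheses (uL : uniq L) (size_L : forall t, t \in L -> size t = k).
Hypothesis perm_L : forall t u, perm_eq t u -> t \in L -> u \in L.

(** Permuting positions is injective on [L] and maps [L] to itself, hence only reorders this finite
    list. *)
Lemma big_permute_seq F s :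
  \sum_(t <- L) F (permute_seq s t) = \sum_(t <- L) F t.
Proof.
rewrite -(big_map (permute_seq s) xpredT F); apply: perm_big.
have uP : uniq (map (permute_seq s) L).
  rewrite map_inj_in_uniq// => t u /size_L tk /size_L uk tu.
  rewrite -(permute_seq1 tk) -(permute_seq1 uk).
  by rewrite -(mulVg s) -!permute_seqM tu.
have [|_ ?] := uniq_min_size uP _ (eq_leq (esym (size_map _ _))).
  move=> _ /mapP[t tL ->]; apply: (perm_L _ tL).
  by rewrite perm_sym perm_permute_seq// size_L.
by apply: uniq_perm.
Qed.

Lemma big_symmetrized F : \sum_(t <- L) symmetrized F t = \sum_(t <- L) F t.
Proof.
rewrite -mulr_sumr exchange_big /=.
under eq_bigr do rewrite big_permute_seq//.
by rewrite sumr_const card_Sn -[X in _ * X]mulr_natl mulKf.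
Qed.

End perm_closed_list.

(** Two sequences with the same entries differ by a permutation of positions, which a translation of
    the sum over the group absorbs. *)
Lemma symmetrized_invariant F : perm_invariant k (symmetrized F).
Proof.
move=> t u tk; rewrite perm_sym => tu; rewrite /symmetrized; congr (_ * _).
have tkb : size t == k by rewrite tk.
have /tuple_permP[p uE] : perm_eq u (Tuple tkb) by [].
have -> : u = permute_seq p t.
  rewrite uE /=; apply: eq_map => i; rewrite (tnth_nth x0) /=.
  by [].
rewrite (reindex_inj (mulIg p)) /=.
by apply: eq_bigr => s _; rewrite permute_seqM.
Qed.

End permuted_sequences.

(** * The measure F_{N,k} at an empirical measure *)

Section discrete_measures.
Context d (Y : measurableType d) (R : realType).
Local Open Scope ereal_scope.

(** [mu] is prescribed on measurable sets only, so it is first replaced by a multiple of a sum of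
    Dirac measures with the same values there. *)
Lemma ge0_integral_discrete (mu : {measure set Y -> \bar R}) (c : R)
    (l : seq Y) (f : Y -> \bar R) : (0 <= c)%R ->
  (forall A, measurable A -> mu A = (c * \sum_(z <- l) \1_A z)%:E) ->
  measurable_fun setT f -> (forall y, 0 <= f y) ->
  \int[mu]_y f y = c%:E * \sum_(z <- l) f z.
Proof.
move=> c0 muE mf f0; pose m n : {measure set Y -> \bar R} := \d_(nth point l n).
rewrite (eq_measure_integral (mscale (NngNum c0) (msum m (size l)))).
  rewrite ge0_integral_mscale// ge0_integral_measure_sum//; congr (_ * _).
  rewrite (big_nth point) big_mkord; apply: eq_bigr => i _.
  by rewrite integral_dirac// diracT mul1e.
move=> A mA _; rewrite muE// /mscale /= /msum EFinM -sumEFin; congr (_ * _).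
rewrite (big_nth point) big_mkord; apply: eq_bigr => i _.
by [].
Qed.

End discrete_measures.

Definition seq_pow (X : ptopologicalType) k (t : seq X) : pow X k :=
  fun i => nth point t i.
Arguments seq_pow {X} k t _.

Section powers.
Variables (R : realType) (X : polishType R).

Lemma id_imageE m (lambda : Prob R X) (A : set (borel (pow X m))) :
  id_image m lambda A = lambda (@diag X m @^-1` A).
Proof. by []. Qed.

Lemma tensorE m n k (mnk : (m + n)%N = k) (mu : Prob R (pow X m))
    (nu : Prob R (pow X n)) (A : set (borel (pow X k))) :
  tensor mnk mu nu A = (\int[mu]_z nu (xsection (concat mnk @^-1` A) z))%E.
Proof. by []. Qed.

Lemma measurable_preimage_diag m (A : set (borel (pow X m))) :
  measurable A -> measurable (@diag X m @^-1` A : set (borel X)).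
Proof.
move=> mA; rewrite -[X in measurable X]setTI.
exact: (@measurable_diag R X m).
Qed.

Lemma measurable_preimage_concat m n k (mnk : (m + n)%N = k)
    (A : set (borel (pow X k))) : measurable A ->
  measurable (concat mnk @^-1` A : set (borel (pow X m) * borel (pow X n))).
Proof.
move=> mA; rewrite -[X in measurable X]setTI.
exact: (@measurable_concat R X m n k mnk).
Qed.

End powers.

(** * Products and diagonal images of an empirical measure *)

Section empirical_powers.
Variables (R : realType) (X : polishType R) (N : nat).

Definition emp_measure (x : 'I_N -> X) (lambda : Prob R X) :=
  forall A : set (borel X), measurable A ->
    lambda A = ((N%:R^-1)%:E * \sum_(i < N) \d_(x i : borel X) A)%E.

Variables (x : 'I_N -> X) (lambda : Prob R X).
Hypothesis lambdaE : emp_measure x lambda.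

(** The law of the sequence obtained by drawing one point of [x] for each block, uniformly and with
    replacement, and repeating it along the block. *)
Definition block_average m (mu : Prob R (pow X m)) (p : seq nat) :=
  forall A : set (borel (pow X m)), measurable A -> mu A =
  (N%:R^-1 ^+ size p * \sum_(t <- blockseqs 'I_N p)
    \1_A (seq_pow m (map x t)))%:E.

Lemma id_image_average m : block_average (id_image m lambda) [:: m].
Proof.
move=> A mA; rewrite id_imageE lambdaE; last exact: measurable_preimage_diag.
rewrite expr1 big_blockseqs_cons EFinM -sumEFin; congr (_ * _)%E.
apply: eq_bigr => i _; rewrite big_seq1 cats0.
rewrite (_ : seq_pow m _ = diag (x i))//; apply/funext => j.
by rewrite /seq_pow map_nseq nth_nseq ltn_ord.
Qed.

Lemma concat_seq_pow m n k (mnk : (m + n)%N = k) (t u : seq X) : size t = m ->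
  concat mnk (seq_pow m t, seq_pow n u) = seq_pow k (t ++ u).
Proof.
move=> tm; apply/funext => i; rewrite /concat /seq_pow nth_cat tm.
case: fintype.splitP => j /= ->.
  by rewrite ltn_ord.
by rewrite ltnNge leq_addr /= addKn.
Qed.

(** Integration over the first factor is a finite sum by [ge0_integral_discrete], and a section of
    the preimage of [A] is tested on [u] by concatenating [t] and [u]. *)
Lemma tensor_average m n k (mnk : (m + n)%N = k) (mu : Prob R (pow X m))
    (nu : Prob R (pow X n)) p q : sumn p = m ->
  block_average mu p -> block_average nu q ->
  block_average (tensor mnk mu nu) (p ++ q).
Proof.
move=> pm muE nuE A mA; pose B := concat mnk @^-1` A.
have mB := measurable_preimage_concat mnk mA.
rewrite tensorE.
pose l := [seq seq_pow m (map x t) | t <- blockseqs 'I_N p].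
rewrite (@ge0_integral_discrete _ (borel (pow X m)) R mu
  (N%:R^-1 ^+ size p) l)//; last 2 first.
- by move=> C mC; rewrite /l big_map; exact: muE.
- exact: measurable_fun_xsection.
rewrite big_map size_cat exprD -mulrA EFinM; congr (_ * _)%E.
rewrite big_blockseqs_cat mulr_sumr -sumEFin big_seq [RHS]big_seq.
apply: eq_bigr => t tp /=; rewrite nuE; last first.
  exact: (@measurable_xsection _ _ (borel (pow X m)) (borel (pow X n)) _ _ mB).
congr ((_ * _)%:E); apply: eq_bigr => u _.
rewrite map_cat -(@concat_seq_pow m n k mnk); last first.
  by rewrite size_map (size_blockseqs tp).
by rewrite !indicE mem_xsection /B; congr (_%:R); congr nat_of_bool.
Qed.

Lemma dirac_average :
  block_average (dirac (point : borel (pow X 0)) : Prob R (pow X 0)) [::].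
Proof.
move=> A _; rewrite expr0 mul1r big_seq1 (_ : seq_pow 0 _ = point)//.
by apply/funext => -[].
Qed.

Lemma mpow_average m : block_average (mpow lambda m) (nseq m 1%N).
Proof.
elim: m => [|m IH].
  exact: dirac_average.
have := @tensor_average 1 m m.+1 (erefl _) _ _ [:: 1%N] (nseq m 1%N) erefl.
by apply => //; exact: id_image_average.
Qed.

Lemma id_tensor_average p : block_average (id_tensor lambda p) p.
Proof.
elim: p => [|m p IH].
  exact: dirac_average.
have := @tensor_average m (sumn p) _ (erefl _) _ _ [:: m] p.
by apply => //; [rewrite /= addn0|exact: id_image_average].
Qed.

Lemma part_measure_average k j (p : parts j k) :
  block_average (part_measure p lambda) (cycle_type k j p).
Proof.
by apply: tensor_average => //; [exact: id_tensor_average|exact: mpow_average].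
Qed.

End empirical_powers.

Lemma mem_blockseqs1 (T : finType) k (t : seq T) :
  (t \in blockseqs T (nseq k 1%N)) = (size t == k).
Proof.
elim: k t => [|k IH] t; first by rewrite inE size_eq0.
apply/allpairsP/idP => [[[y u] /= [_ + ->]]|]; first by rewrite IH.
case: t => // y u /=; rewrite eqSS -IH => uk.
by exists (y, u); rewrite mem_enum.
Qed.

Lemma blockseqs1_uniq (T : finType) k : uniq (blockseqs T (nseq k 1%N)).
Proof.
elim: k => //= k IH; apply: allpairs_uniq => //; first exact: enum_uniq.
by move=> [y u] [z v] _ _ /= [-> ->].
Qed.

(** * The measure [FNk] as a sampling without replacement *)

Section FNk_empirical.
Variables (R : realType) (X : polishType R) (N k : nat).
Hypotheses (k0 : (0 < k)%N) (kN : (k <= N)%N).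

Lemma FNk_valE (lambda : Prob R X) (A : set (borel (pow X k))) :
  FNk N k lambda A =
  ((N%:R ^+ k.-1 / \prod_(1 <= i < k) (N%:R - i%:R))%:E *
  (mpow lambda k A + \sum_(j <- index_iota 1 k) (((-1) ^+ j / N%:R ^+ j)%:E *
    ((k`!%:R^-1)%:E * \sum_(s <- index_enum {perm 'I_k})
      \sum_(p <- index_enum (parts j k))
        ((part_coef R p)%:E *
          part_measure p lambda (permute s @^-1` A)))))%E)%E.
Proof. by []. Qed.

Lemma measurable_preimage_permute s (A : set (borel (pow X k))) :
  measurable A -> measurable (@permute X k s @^-1` A : set (borel (pow X k))).
Proof.
move=> mA; rewrite -[X in measurable X]setTI.
exact: (@measurable_permute R X k s).
Qed.

Lemma permute_seq_pow (i0 : 'I_N) (x : 'I_N -> X) s (t : seq 'I_N) :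
  size t = k ->
  permute s (seq_pow k (map x t)) = seq_pow k (map x (permute_seq i0 s t)).
Proof.
move=> tk; apply/funext => i; rewrite /permute /seq_pow.
by rewrite !(nth_map i0) ?tk ?size_permute_seq// nth_permute_seq.
Qed.

(** [N ^_ k] is the number of injective sequences of length [k], and at an empirical measure every
    term of [FNk] carries the factor [N%:R^-1 ^+ k]. *)
Lemma normalization : N%:R ^+ k.-1 / \prod_(1 <= i < k) (N%:R - i%:R) *
  N%:R^-1 ^+ k = (N ^_ k)%:R^-1 :> R.
Proof.
have N0 : N%:R != 0 :> R by rewrite pnatr_eq0; lia.
have -> : (N ^_ k)%:R = N%:R * \prod_(1 <= i < k) (N%:R - i%:R) :> R.
  rewrite ffact_prod natr_prod -(big_mkord xpredT (fun i => (N - i)%N%:R)).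
  rewrite big_ltn// subn0; congr (_ * _).
  rewrite big_nat [RHS]big_nat; apply: eq_bigr => i /andP[_ ik].
  by rewrite natrB// ltnW// (leq_trans ik).
rewrite invfM mulrC mulrA; congr (_ * _).
by rewrite -[in LHS](prednK k0) exprSr mulrAC -exprMn mulVf// expr1n mul1r.
Qed.

(** The [j]-th term is a sum over cycle types with [k - j] cycles: its weight [N^{-j}] and the
    [N^{-(k - j)}] of the block averages combine to the same power for all [j], and [(-1)^j] is the
    sign of the cycle type. Hence [sum_partitions_injseqs] applies. *)
Lemma FNk_empirical (x : 'I_N -> X) (lambda : Prob R X)
    (A : set (borel (pow X k))) : emp_measure x lambda -> measurable A ->
  FNk N k lambda A = ((N ^_ k)%:R^-1 *
    \sum_(t <- injseqs 'I_N k) \1_A (seq_pow k (map x t)))%:E.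
Proof.
move=> lambdaE mA; pose i0 := Ordinal (leq_trans k0 kN).
pose G t : R := \1_A (seq_pow k (map x t)).
(* [symmetrize] is moved from the measures to the indicator of [A], which gives the invariance that
   [sum_partitions_injseqs] requires. *)
pose H := symmetrized (R := R) i0 k G.
have N0 : N%:R != 0 :> R by rewrite pnatr_eq0; lia.
have injE : \sum_(t <- injseqs 'I_N k) G t = \sum_(t <- injseqs 'I_N k) H t.
  apply/esym/big_symmetrized; first exact: injseqs_uniq.
    by move=> t; rewrite mem_injseqs => /andP[_ /eqP].
  by move=> t u tu; rewrite !mem_injseqs (perm_uniq tu) (perm_size tu).
pose a j : R :=
  \sum_(p : parts j k) part_coef R p *
    \sum_(t <- blockseqs 'I_N (cycle_type k j p)) H t.
(* The power of [lambda] is the term [j = 0], given by the empty partition with coefficient one. The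
   list of all words is closed under permutations, so [G] may be replaced by [H]. *)
have a0 : mpow lambda k A = (N%:R^-1 ^+ k * a 0)%:E.
  rewrite (mpow_average lambdaE)// size_nseq; congr ((_ * _)%:E).
  transitivity (\sum_(t <- blockseqs 'I_N (nseq k 1%N)) H t).
    apply/esym/big_symmetrized; first exact: blockseqs1_uniq.
      by move=> t; rewrite mem_blockseqs1 => /eqP.
    by move=> t u tu; rewrite !mem_blockseqs1 (perm_size tu).
  have /part_seqP[p pE] :
    is_partition 0 [::] && (0 + @size nat [::] <= k)%N by [].
  rewrite /a (bigD1 p)//= [X in _ + X]big1 ?addr0; last first.
    move=> q; rewrite -(inj_eq (@part_seq_inj 0 k)) pE.
    have [_ + + _] := partsP q; case: (part_seq q) => // -[|i] r //=.
  rewrite /part_coef pE /cycle_type /= !big_nil !mulr1 !subn0 divff ?mul1r//.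
have aj j (s : {perm 'I_k}) (p : parts j k) :
    part_measure p lambda (permute s @^-1` A) =
    (N%:R^-1 ^+ (k - j) * \sum_(t <- blockseqs 'I_N (cycle_type k j p))
      G (permute_seq i0 s t))%:E.
  rewrite (part_measure_average lambdaE); last first.
    exact: measurable_preimage_permute.
  rewrite size_cycle_type; congr ((_ * _)%:E).
  rewrite big_seq [RHS]big_seq; apply: eq_bigr => t /size_blockseqs tk.
  rewrite /G -permute_seq_pow//.
  by rewrite tk; have /and3P[_ _ /eqP] := cycle_type_partition p.
rewrite FNk_valE a0.
rewrite (_ : \sum_(j <- index_iota 1 k) _ =
    (\sum_(1 <= j < k) N%:R^-1 ^+ k * ((-1) ^+ j * a j))%:E)%E; last first.
  rewrite -sumEFin big_seq [RHS]big_seq; apply: eq_bigr => j.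
  rewrite mem_index_iota => /andP[_ jk].
  transitivity (((-1) ^+ j / N%:R ^+ j * (k`!%:R^-1 * \sum_(s : {perm 'I_k})
    \sum_(p : parts j k) (part_coef R p * (N%:R^-1 ^+ (k - j) *
      \sum_(t <- blockseqs 'I_N (cycle_type k j p))
        G (permute_seq i0 s t)))))%:E).
    rewrite !EFinM -!sumEFin; congr (_ * (_ * _))%E; apply: eq_bigr => s _.
    by rewrite -sumEFin; apply: eq_bigr => p _; rewrite aj.
  have f0 : k`!%:R != 0 :> R by [].
  congr EFin; transitivity ((-1) ^+ j / N%:R ^+ j * (k`!%:R^-1 *
      (N%:R^-1 ^+ (k - j) * (k`!%:R * a j)))).
    congr (_ * (_ * _)); rewrite exchange_big /a !mulr_sumr /=.
    apply: eq_bigr => p _; rewrite -!mulr_sumr exchange_big /=.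
    by field.
  rewrite [k`!%:R^-1 * _]mulrCA mulKf// -[in RHS](subnKC (ltnW jk)) exprD.
  by rewrite -exprVn; ring.
rewrite -EFinD -EFinM; congr EFin.
rewrite -mulr_sumr -mulrDr mulrA normalization -/G injE; congr (_ * _).
rewrite -sum_partitions_injseqs; last exact: symmetrized_invariant.
rewrite big_partitions_cycle_type// [RHS]big_ltn//; congr (_ + _).
  apply: eq_bigr => p _; rewrite size_cycle_type subn0 subnn expr0 mul1r.
  by rewrite zpart_cycle_type.
rewrite [LHS]big_nat [RHS]big_nat; apply: eq_bigr => j /andP[_ jk].
rewrite mulr_sumr; apply: eq_bigr => p _.
by rewrite size_cycle_type subKn ?(ltnW jk)// zpart_cycle_type mulrA.
Qed.

End FNk_empirical.

(** * Borel measures on Polish spaces *)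

Section metric.
Variables (R : realType) (T : topologicalType) (d : T -> T -> R).
Hypothesis dT : metrizes d.

Let d0 x : d x x = 0. Proof. by case: dT => /(_ x x)[_ ->]. Qed.
Let dC x y : d x y = d y x. Proof. by case: dT. Qed.
Let dD x y z : d x z <= d x y + d y z.
Proof. by case: dT => _ _ /(_ x y z). Qed.

Lemma metric_ge0 x y : 0 <= d x y.
Proof.
have := dD x y x; rewrite d0 (dC y x) -mulr2n.
by rewrite pmulrn_lge0.
Qed.

Lemma metric_nbhsP x (A : set T) :
  nbhs x A <-> exists2 e, 0 < e & [set y | d x y < e] `<=` A.
Proof. by case: dT => _ _ _ ->; split=> -[e e0 eA]; exists e. Qed.

Lemma metric_ball_open x e : open [set y | d x y < e].
Proof.
rewrite openE => y /= xy; apply/metric_nbhsP; exists (e - d x y).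
  by rewrite subr_gt0.
by move=> z /= yz; apply: le_lt_trans (dD x y z) _; rewrite -ltrBrDl.
Qed.

Lemma bigcap_metric_ball a :
  [set a] = \bigcap_n [set y | d a y < n.+1%:R^-1].
Proof.
apply/seteqP; split=> [_ -> n _ /=|y ya]; first by rewrite d0.
have [d1 _ _ _] := dT.
apply/esym/d1/eqP; rewrite eq_le metric_ge0 andbT leNgt; apply/negP.
by move=> /ltr_add_invr[k]; rewrite add0r ltNge (ltW (ya k I)).
Qed.

Lemma metric_lipschitz_continuous (f : T -> R) :
  (forall x y, f x <= f y + d x y) -> continuous f.
Proof.
move=> fl x; apply/cvgrPdist_lt => e e0.
apply/metric_nbhsP; exists e => // y /= xy.
rewrite ltr_norml; apply/andP; split.
  have := fl y x; rewrite dC => h; lra.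
have := fl x y => h; lra.
Qed.

(** The functions [min 1 (n * D)], with [D] the distance to the complement of [U], increase to the
    indicator of [U]. If the complement is empty, the constant one is taken. *)
Lemma open_approximation (U : set T) : open U ->
  exists f : nat -> T -> R, [/\ forall n, continuous (f n),
    forall n x, 0 <= f n x <= 1,
    forall x, nondecreasing_seq (f ^~ x) &
    forall x, f n x @[n --> \oo] --> (\1_U x : R)].
Proof.
move=> oU; have [/(congr1 setC)|/set0P[u Uu]] := eqVneq (~` U) set0.
  rewrite setCK setC0 => ->; exists (fun _ _ => 1); split.
  - by move=> n x; exact: cvg_cst.
  - by move=> n x; rewrite ler01 lexx.
  - by move=> x m n _; exact: lexx.
  - by move=> x; rewrite indicT; exact: cvg_cst.
pose S x := [set d x y | y in ~` U].
have S0 x : S x !=set0 by exists (d x u), u.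
have lS x : lbound (S x) 0 by move=> _ [y _ <-]; exact: metric_ge0.
have hS x : has_inf (S x) by split; [exact: S0|exists 0; exact: lS].
pose D x := inf (S x).
have D0 x : 0 <= D x by apply: lb_le_inf.
have DU x : ~ U x -> D x = 0.
  move=> Ux; apply/eqP; rewrite eq_le D0 andbT.
  apply: ge_inf; first by exists 0.
  by exists x.
have Dl x y : D x <= D y + d x y.
  rewrite -lerBlDr; apply: lb_le_inf => // _ [z Uz <-].
  rewrite lerBlDr (le_trans _ (_ : d x z <= _))//.
    by apply: ge_inf; [exists 0|exists z].
  by rewrite addrC.
have cD := metric_lipschitz_continuous Dl.
have Dgt x : U x -> 0 < D x.
  move=> Ux; have /metric_nbhsP[e e0 eU] : nbhs x U by exact: open_nbhs_nbhs.
  apply: lt_le_trans e0 _; apply: lb_le_inf => // _ [z Uz <-].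
  by rewrite leNgt; apply/negP => /eU.
exists (fun n x => Num.min 1 (n%:R * D x)); split.
- move=> n x; apply: (@continuous_min _ _ (fun=> 1) (fun x => n%:R * D x)).
    exact: cvg_cst.
  exact: cvgMl_tmp (cD x).
- by move=> n x; rewrite ge_min lexx le_min ler01 mulr_ge0.
- move=> x m n mn; rewrite le_min ge_min lexx /= ge_min.
  by rewrite ler_wpM2r ?ler_nat ?orbT.
- move=> x; have [Ux|Ux] := pselect (U x).
    rewrite indicE mem_set//; apply: cvg_near_cst.
    exists (Num.truncn (D x)^-1).+1 => // n /= xn; apply/eqP.
    rewrite eq_minl; have Dx := Dgt x Ux.
    rewrite -ler_pdivrMr// mul1r ltW// (lt_le_trans (truncnS_gt _))//.
    by rewrite ler_nat.
  rewrite indicE memNset// DU//; apply: cvg_near_cst; apply: nearW => n.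
  by rewrite mulr0; apply/min_idPr; exact: ler01.
Qed.

End metric.

(** * Metrizability of the powers of a Polish space *)

Definition sum_metric (R : realType) (X : Type) (d : X -> X -> R) n
  (x y : pow X n) : R := \sum_(i < n) d (x i) (y i).

Lemma sum_metrizes (R : realType) (X : ptopologicalType) (d : X -> X -> R) n :
  metrizes d -> @metrizes R (pow X n) (@sum_metric R X d n).
Proof.
move=> dX; have d_ge0 := metric_ge0 dX; have [d0 dC dD dN] := dX.
split.
- move=> x y; split=> [|->]; last first.
    by rewrite /sum_metric big1// => i _; apply/d0.
  move=> /eqP; rewrite psumr_eq0// => /allP xy; apply/funext => i.
  by apply/d0/eqP; apply: (implyP (xy i _)); rewrite ?mem_index_enum.
- by move=> x y; apply: eq_bigr => i _; exact: dC.
- move=> x y z; rewrite /sum_metric -big_split.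
  by apply: ler_sum => i _; exact: dD.
move=> x; apply/seteqP; split=> A.
  move=> /pow_nbhs_box[V nV VA].
  have e_ i : {e : R | 0 < e & [set y | d (x i) y < e] `<=` V i}.
    by apply: cid2; exact/(metric_nbhsP dX).
  pose e := \big[Num.min/1]_(i < n) s2val (e_ i).
  exists e.
    rewrite /e; elim/big_ind: _ => //= [a b a0 b0|i _].
      by rewrite lt_min a0 b0.
    exact: s2valP (e_ i).
  move=> y /= xy; apply: VA => i; apply: (s2valP' (e_ i)) => /=.
  have ei : e <= s2val (e_ i) by exact: bigmin_le_cond.
  apply: le_lt_trans (lt_le_trans xy ei).
  by rewrite /sum_metric (bigD1 i)//= lerDl sumr_ge0.
move=> [e /= e0 eA].
(* With [n.+1] in place of [n], the case [n = 0] is covered and the sum of [n] terms stays strictly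
   below [e]. *)
have e1 : 0 < e / n.+1%:R by rewrite divr_gt0.
have : nbhs x [set y : pow X n | forall i, d (x i) (y i) < e / n.+1%:R].
  apply: (@filter_forall _ _ (fun i (y : pow X n) => d (x i) (y i) < _)
    (nbhs x) (@nbhs_filter (pow X n) x)) => i.
  have xe : nbhs (x i) [set z | d (x i) z < e / n.+1%:R].
    by apply/(metric_nbhsP dX); exists (e / n.+1%:R).
  exact: (@proj_continuous _ (fun=> X) i x _ xe).
apply: filterS => y xy; apply: eA => /=.
apply: (@le_lt_trans _ _ (\sum_(i < n) e / n.+1%:R)).
  by apply: ler_sum => i _; exact: ltW.
rewrite sumr_const card_ord -[X in X < _]mulr_natr mulrAC ltr_pdivrMr//.
by rewrite ltr_pM2l// ltr_nat.
Qed.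

Lemma polish_metrizes (R : realType) (X : polishType R) :
  exists d : X -> X -> R, metrizes d.
Proof. by have [d dX _] := @polish_completely_metrizable R X; exists d. Qed.

Lemma pow_open_approximation (R : realType) (X : polishType R) n
    (U : set (pow X n)) : open U ->
  exists f : nat -> pow X n -> R, [/\ forall n, continuous (f n),
    forall n x, 0 <= f n x <= 1,
    forall x, nondecreasing_seq (f ^~ x) &
    forall x, f n x @[n --> \oo] --> (\1_U x : R)].
Proof.
have [d dX] := polish_metrizes X.
exact: (@open_approximation R (pow X n) _ (sum_metrizes n dX)).
Qed.

Lemma continuous_borel_measurable (R : realType) (Y : ptopologicalType)
    (f : Y -> R) : continuous f -> measurable_fun setT (f : borel Y -> R).
Proof.
move=> /continuousP cf.
apply: (measurability _ (RGenOpens.measurableE R)) => _ [_ [a [b ->]] <-].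
rewrite setTI; apply: sub_sigma_algebra; apply: cf; exact: interval_open.
Qed.

Lemma bounded_fun_ex (R : realType) (T : Type) (f : T -> R) :
  bounded_fun f <-> exists M, forall x, `|f x| <= M.
Proof.
split=> [[M [_ /(_ (M + 1))]]|[M fM]].
  by rewrite ltrDl => /(_ ltr01) fM; exists (M + 1) => x; exact: fM.
exists M; split; first exact: num_real.
by move=> m Mm x _; exact: le_trans (fM x) (ltW Mm).
Qed.

(** Adding a constant reduces a test function to a nonnegative one, to which the integration
    formulas for nonnegative functions apply. *)
Lemma bounded_continuous_shift (R : realType) (Y : topologicalType)
    (f : Y -> R) : bounded_continuous f ->
  exists M, bounded_continuous (fun y => f y + M) /\ forall y, 0 <= f y + M.
Proof.
move=> [cf /bounded_fun_ex[M fM]]; exists M; split; last first.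
  move=> y; have := fM y; rewrite ler_norml => /andP[].
  by rewrite -lerBlDr sub0r.
split=> [y|].
  exact: (@cvgD R R^o _ (nbhs y) _ f (fun=> M) (f y) M (cf y) (cvg_cst M)).
apply/bounded_fun_ex; exists (M + `|M|) => y.
by rewrite (le_trans (ler_normD _ _))// lerD2r.
Qed.

(** * Borel measures tested on bounded continuous functions *)

Section borel_measures.
Variables (R : realType) (Y : ptopologicalType).
Local Open Scope ereal_scope.

Lemma bounded_continuous_integrable (mu : Prob R Y) (f : Y -> R) :
  bounded_continuous f -> mu.-integrable setT (EFin \o f).
Proof.
move=> [cf bf]; apply: measurable_bounded_integrable => //.
  by rewrite (le_lt_trans (probability_le1 _ _))// ltry.
exact: continuous_borel_measurable.
Qed.

(** The real-valued integral is continuous in [mu] by the choice of the narrow topology, hence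
    Borel. *)
Lemma measurable_integral_bounded_continuous (f : Y -> R) :
  bounded_continuous f ->
  measurable_fun setT ((fun mu : Prob R Y => \int[mu]_y (f y)%:E) :
    borel (Prob R Y) -> \bar R).
Proof.
move=> bf; apply: (eq_measurable_fun
    (fun mu : borel (Prob R Y) => (\int[(mu : Prob R Y)]_y f y)%R%:E)).
  move=> mu _; rewrite fineK//; apply: integrable_fin_num => //.
  exact: bounded_continuous_integrable.
apply/measurable_EFinP; apply: continuous_borel_measurable => mu.
by have /narrow_cvgP := @cvg_id _ (nbhs (mu : Prob R Y)); apply.
Qed.

(** The consequence of metrizability that is shared by [X] and its powers. *)
Definition approximable (U : set Y) := exists f : nat -> Y -> R,
  [/\ forall n, continuous (f n),
    forall n x, (0 <= f n x <= 1)%R,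
    forall x, nondecreasing_seq (f ^~ x) &
    forall x, f n x @[n --> \oo] --> (\1_U x : R)].

Hypothesis approx : forall U : set Y, open U -> approximable U.

Lemma approximable_measure (U : set Y) : open U -> exists f : nat -> Y -> R,
  [/\ forall n, bounded_continuous (f n), forall n y, (0 <= f n y)%R &
    forall mu : {measure set (borel Y) -> \bar R},
      \int[mu]_y (f n y)%:E @[n --> \oo] --> mu U].
Proof.
move=> oU; have [f [cf f01 ndf fU]] := approx oU; exists f; split.
- move=> n; split; first exact: cf.
  apply/bounded_fun_ex; exists 1%R => y.
  by have /andP[f0 f1] := f01 n y; rewrite ger0_norm.
- by move=> n y; have /andP[] := f01 n y.
move=> mu; have mU : measurable (U : set (borel Y)).
  exact: sub_sigma_algebra.
have mf n : measurable_fun setT (EFin \o f n : borel Y -> \bar R).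
  by apply/measurable_EFinP; exact: (@continuous_borel_measurable R Y _ (cf n)).
have -> : mu U = \int[mu]_y (fun y => limn (fun n => (f n y)%:E)) y.
  have := integral_indic mu measurableT mU; rewrite setIT => <-.
  apply: eq_integral => y _.
  by apply/esym/cvg_lim => //; apply: cvg_EFin (fU y); exact: nearW.
apply: (@cvg_monotone_convergence _ _ _ mu setT measurableT
  (fun n => EFin \o f n)) => //.
- by move=> n y _; rewrite lee_fin; have /andP[] := f01 n y.
- by move=> y _ m n mn; rewrite lee_fin; exact: ndf.
Qed.

(** Open sets are stable under intersection and generate the Borel sets; on them both measures are
    limits of integrals. [nu] is a general measure in order to include mixtures, which are built as
    subprobabilities. *)
Lemma eq_measure_bounded_continuous (mu : Prob R Y)
    (nu : {measure set (borel Y) -> \bar R}) :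
  (forall f : Y -> R, bounded_continuous f -> (forall y, (0 <= f y)%R) ->
    \int[mu]_y (f y)%:E = \int[nu]_y (f y)%:E) ->
  forall A : set (borel Y), measurable A -> mu A = nu A.
Proof.
move=> mn A mA.
apply: (@measure_unique _ R (borel Y) (@open Y) (fun=> setT)) => //.
- by move=> U V oU oV; exact: openI.
- by move=> _; exact: openT.
- by rewrite bigcup_const.
- move=> U oU; have [f [bf f0 fU]] := approximable_measure oU.
  have fmu := fU mu; have fnu := fU nu.
  have E : (fun n => \int[mu]_y (f n y)%:E) = (fun n => \int[nu]_y (f n y)%:E).
    by apply/funext => n; exact: mn.
  by rewrite E in fmu; exact: cvg_unique fmu fnu.
- by move=> _; rewrite (le_lt_trans (probability_le1 _ _))// ltry.
Qed.

(** Evaluation at an open set is a limit of Borel functions of [mu], and a Dynkin argument extends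
    this to all Borel sets. *)
Lemma measurable_eval (A : set (borel Y)) : measurable A ->
  measurable_fun setT ((fun mu : Prob R Y => mu A) :
    borel (Prob R Y) -> \bar R).
Proof.
move=> mA; have : <<s @open Y >> A by [].
apply: (@dynkin_induction _ (borel Y) (@open Y) [set A | measurable_fun setT
  ((fun mu : Prob R Y => mu A) : borel (Prob R Y) -> \bar R)]) => //=.
- by move=> U V oU oV; exact: openI.
- apply: (eq_measurable_fun (cst 1)) => // mu _.
  by rewrite probability_setT.
- move=> U oU; have [f [bf f0 fU]] := approximable_measure oU.
  apply: (emeasurable_fun_cvg (fun n (mu : borel (Prob R Y)) =>
    \int[(mu : Prob R Y)]_y (f n y)%:E)).
    by move=> n; exact: measurable_integral_bounded_continuous.
  by move=> mu _; exact: fU.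
- move=> S mS HS; apply: (eq_measurable_fun
    (fun mu : borel (Prob R Y) => 1 - (mu : Prob R Y) S)).
    by move=> mu _; rewrite probability_setC.
  exact: emeasurable_funB.
- move=> F mF tF HF; apply: (eq_measurable_fun
    (fun mu : borel (Prob R Y) => \sum_(0 <= k <oo) (mu : Prob R Y) (F k))).
    by move=> mu _; rewrite measure_semi_bigcup//; exact: bigcup_measurable.
  exact: ge0_emeasurable_sum.
Qed.

End borel_measures.

(** * The set of empirical measures *)

Lemma approximable_open (R : realType) (X : polishType R) (U : set X) :
  open U -> @approximable R X U.
Proof.
by have [d dX] := polish_metrizes X; exact: (open_approximation dX).
Qed.

Lemma big_flatten_nseq (R : nmodType) (T : eqType) (l : seq T) (j : T -> nat)
    (f : T -> R) :
  \sum_(z <- flatten [seq nseq (j a) a | a <- l]) f z =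
  \sum_(a <- l) f a *+ j a.
Proof.
rewrite big_flatten big_map; apply: eq_bigr => a _.
by rewrite big_nseq iter_addr_0.
Qed.

Section empirical.
Variables (R : realType) (X : polishType R) (N : nat).
Hypothesis N0 : (0 < N)%N.
Local Open Scope ereal_scope.

Definition grid : set (\bar R) :=
  [set (j%:R / N%:R)%:E | j in [set j : nat | (j <= N)%N]].

Lemma finite_grid : finite_set grid.
Proof. by apply: finite_image; exact: (finite_II N.+1). Qed.

(** Closedness lets membership in the grid pass to limits along monotone sequences of sets. *)
Lemma closed_grid : closed grid.
Proof.
apply: (accessible_finite_set_closed.1 _ _ finite_grid).
exact: hausdorff_accessible (@ereal_hausdorff R).
Qed.

Lemma grid_lt x : grid x -> x < (N%:R^-1)%:E -> x = 0.
Proof.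
move=> [[|j] _ <-]; first by rewrite mul0r.
rewrite lte_fin ltr_pdivrMr ?ltr0n// mulVf ?pnatr_eq0 -?lt0n//.
by rewrite ltrn1.
Qed.

Lemma empirical_grid (lambda : Prob R X) (A : set (borel X)) :
  empirical N lambda -> measurable A -> grid (lambda A).
Proof.
move=> [x lx] mA; rewrite lx//; exists (\sum_(i < N) (x i \in A))%N.
  rewrite /= (leq_trans (_ : _ <= \sum_(i < N) 1)%N)//.
    by apply: leq_sum => i _; exact: leq_b1.
  by rewrite sum1_card card_ord.
rewrite mulrC EFinM; congr (_ * _).
rewrite natr_sum -sumEFin; apply: eq_bigr => i _.
by [].
Qed.

Let measurable_point (a : X) : measurable ([set a] : set (borel X)).
Proof.
have [d dX] := polish_metrizes X; rewrite (bigcap_metric_ball dX).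
apply: bigcapT_measurable => n; apply: sub_sigma_algebra.
exact: metric_ball_open.
Qed.

Section grid_empirical.
Variable lambda : Prob R X.
Hypothesis lambda_grid : forall U : set X, open U -> grid (lambda U).

Let w a := lambda ([set a] : set (borel X)).

Let ball_cvg (d : X -> X -> R) a : metrizes d ->
  lambda ([set y | (d a y < n.+1%:R^-1)%R] : set (borel X))
    @[n --> \oo] --> w a.
Proof.
move=> dX; have aE := bigcap_metric_ball dX a.
rewrite /w aE; apply: (@nonincreasing_cvg_mu _ (borel X) R lambda
  (fun n => [set y | (d a y < n.+1%:R^-1)%R])).
- apply: le_lt_trans (probability_le1 _ _) (ltry _).
  by apply: sub_sigma_algebra; exact: metric_ball_open.
- by move=> n; apply: sub_sigma_algebra; exact: metric_ball_open.
- by rewrite -aE; exact: measurable_point.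
- move=> m n mn; apply/subsetPset => y /= /lt_le_trans; apply.
  by rewrite lef_pV2 ?posrE// ler_nat.
Qed.

Let grid_w a : grid (w a).
Proof.
have [d dX] := polish_metrizes X.
apply: (closed_cvg grid closed_grid _ _ (ball_cvg dX)).
by apply: nearW => n; apply: lambda_grid; exact: metric_ball_open.
Qed.

Let S := [set a | w a != 0].

(** By the gap in the grid each point of [S] has mass at least [1/N], so [N.+1] of them would exceed
    the total mass one. *)
Let finite_S : finite_set S.
Proof.
apply: contrapT => /(@infinite_set_fset _ _ N.+1)[B BS NB].
pose V : set (borel X) := \big[setU/set0]_(a <- finmap.enum_fset B) [set a].
have mV : measurable V.
  by apply: bigsetU_measurable => a _; exact: measurable_point.
have : lambda V <= 1 by exact: probability_le1.
rewrite /V measure_fbigsetU; last 2 first.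
- by move=> a _; exact: measurable_point.
- by move=> a b _ _ [c [/= -> ->]].
apply/negP; rewrite -ltNge.
apply: (@lt_le_trans _ _ (\sum_(a <- finmap.enum_fset B) (N%:R^-1)%:E)).
  rewrite sumEFin lte_fin big_const_seq count_predT iter_addr_0.
  rewrite -[ltRHS]mulr_natr mulrC ltr_pdivlMr ?ltr0n// mul1r ltr_nat.
  exact: NB.
rewrite big_seq [leRHS]big_seq; apply: lee_sum => a aB; rewrite leNgt.
by apply/negP => /(grid_lt (grid_w a))/eqP; apply/negP; exact: BS.
Qed.

Let measurable_S : measurable (S : set (borel X)).
Proof.
rewrite (_ : S = \bigcup_(a in S) [set a]); last first.
  by apply/seteqP; split=> [a|a [b Sb ->]//]; exists a.
by apply: fin_bigcup_measurable => // a _; exact: measurable_point.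
Qed.

(** A point of mass zero has a ball of mass below [1/N], hence of mass zero, and so lies in a null
    member of the countable base. *)
Let S_full : lambda (~` S : set (borel X)) = 0.
Proof.
have [d dX] := polish_metrizes X; have [d0 _ _ _] := dX.
have [B cB [Bo Bb]] := @polish_second_countable R X.
have [B0|[e]] := elimT pfcard_geP cB.
  by have [V [+ _] _] := Bb point setT filterT; rewrite B0.
have oe m : open (e m : set X) by apply: Bo; exact: funS.
apply: measure_negligible; first exact: measurableC.
pose F m : set (borel X) := if lambda (e m) == 0 then e m else set0.
apply: (@negligibleS _ (borel X) _ _ (\bigcup_m F m)); last first.
  apply: negligible_bigcup => m; rewrite /F; case: ifPn => [/eqP em|_].
    by exists (e m); split=> //; apply: sub_sigma_algebra; exact: oe.
  exact: negligible_set0.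
move=> a /= /negP; rewrite negbK => /eqP wa.
have Na : nbhs (w a) [set z | z < (N%:R^-1)%:E].
  rewrite wa; apply: open_nbhs_nbhs; split; first exact: open_ereal_lt_ereal.
  by rewrite /= lte_fin invr_gt0 ltr0n.
have [n _ /(_ n (leqnn n)) /= an] := ball_cvg dX Na.
have oU := metric_ball_open dX a (n.+1%:R^-1)%R.
have U0 := grid_lt (lambda_grid oU) an.
have [|C [BC Ca] CU] := Bb a [set y | (d a y < n.+1%:R^-1)%R].
  by apply: open_nbhs_nbhs; split=> //=; rewrite (d0 a a).2.
have [m _ mC] := @surj _ _ _ _ e _ BC.
exists m => //; rewrite /F mC ifT//; apply/eqP/le_anti.
rewrite measure_ge0 -U0 andbT; apply: le_measure => //; rewrite inE.
  by apply: sub_sigma_algebra; exact: Bo.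
exact: sub_sigma_algebra.
Qed.

(** [lambda] lives on finitely many atoms [a] with masses [j a / N]. Repeating each atom [j a] times
    gives a list, whose length is [N] because the total mass is one. *)
Lemma grid_empirical : empirical N lambda.
Proof.
have /finite_fsetP[B SB] := finite_S.
have wE a : {j : nat | w a = (j%:R / N%:R)%:E}.
  by apply: cid; have [j _ <-] := grid_w a; exists j.
pose j a := sval (wE a).
have lE (A : set (borel X)) : measurable A -> lambda A =
    (N%:R^-1 * \sum_(a <- finmap.enum_fset B) \1_A a *+ j a)%:E.
  move=> mA; transitivity (lambda (A `&` S)).
    rewrite (measureDI _ mA measurable_S) [X in X + _](_ : _ = 0) ?add0e//.
    apply/le_anti; rewrite measure_ge0 andbT -S_full le_measure// inE.
      exact: measurableD.
    exact: measurableC.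
  rewrite (_ : A `&` S = \big[setU/set0]_(a <- finmap.enum_fset B)
      (A `&` [set a])); last first.
    rewrite -bigcup_fset -setI_bigcupr -SB; congr (_ `&` _).
    by apply/seteqP; split=> [a Sa|a [b Sb ->]//]; exists a.
  rewrite measure_fbigsetU; last 2 first.
  - by move=> a _; apply: measurableI => //; exact: measurable_point.
  - by move=> a b _ _ [c [[_ /= ->] [_ /= ->]]].
  rewrite mulr_sumr -sumEFin; apply: eq_bigr => a _.
  rewrite indicE; have [aA|aA] := boolP (a \in A).
    rewrite setIidr; last by move=> _ ->; rewrite inE in aA.
    by rewrite [LHS](svalP (wE a)) mulrC.
  rewrite mul0rn mulr0 (_ : A `&` _ = set0) ?measure0//.
  by apply/seteqP; split=> // b [Ab ba]; rewrite -ba (mem_set Ab) in aA.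
pose L := flatten [seq nseq (j a) a | a <- finmap.enum_fset B].
have LE (A : set (borel X)) : measurable A ->
    lambda A = (N%:R^-1 * \sum_(z <- L) \1_A z)%:E.
  by move=> mA; rewrite lE// big_flatten_nseq.
have LN : size L = N.
  have := LE setT measurableT; rewrite probability_setT => -[].
  rewrite (eq_bigr (fun=> 1%R)) => [|z _]; last by rewrite indicT.
  rewrite big_const_seq count_predT iter_addr_0.
  move=> /(congr1 ( *%R N%:R)); rewrite mulr1 mulVKf ?pnatr_eq0 -?lt0n//.
  by move=> /eqP; rewrite eqr_nat => /eqP.
exists (fun i => nth point L i) => A mA.
rewrite LE// EFinM -sumEFin (big_nth point) LN big_mkord; congr (_ * _).
Qed.

End grid_empirical.

(** The finite unions of basic open sets are countably many, so the grid condition on them is Borel.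
    It extends to every open set, which is an increasing union of such sets, and then
    [grid_empirical] applies. *)
Lemma measurable_empirical : measurable (empirical N : set (borel (Prob R X))).
Proof.
have [B cB [Bo Bb]] := @polish_second_countable R X.
have [B0|[e]] := elimT pfcard_geP cB.
  by have [V [+ _] _] := Bb point setT filterT; rewrite B0.
have oe m : open (e m : set X) by apply: Bo; exact: funS.
pose V (s : seq nat) : set X := \bigcup_(i in [set` s]) e i.
have oV s : open (V s) by apply: bigcup_open.
have mV s : measurable (V s : set (borel X)) by exact: sub_sigma_algebra.
have -> : empirical N = ~` \bigcup_(s in [set: seq nat])
    [set lambda : Prob R X | ~ grid (lambda (V s : set (borel X)))].
  apply/seteqP; split=> lambda.
    by move=> lN [s _] /=; apply; exact: empirical_grid.
  move=> /= lV; have {}lV s : grid (lambda (V s : set (borel X))).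
    by apply: contrapT => ns; apply: lV; exists s.
  apply: grid_empirical => U oU.
  pose s n := [seq i <- iota 0 n | `[< e i `<=` U >]].
  have UE : U = \bigcup_n V (s n).
    apply/seteqP; split=> [u Uu|u [n _ [i /=]]]; last first.
      by rewrite mem_filter => /andP[/asboolP iU _]; exact: iU.
    have [C [BC Cu] CU] := Bb u U (open_nbhs_nbhs (conj oU Uu)).
    have [m _ mC] := @surj _ _ _ _ e _ BC.
    exists m.+1 => //; exists m; last by rewrite mC.
    rewrite /= mem_filter mem_iota leq0n add0n ltnSn !andbT.
    by apply/asboolP; rewrite mC.
  have cU : lambda (V (s n) : set (borel X)) @[n --> \oo] -->
      lambda (\bigcup_n V (s n) : set (borel X)).
    apply: (@nondecreasing_cvg_mu _ (borel X)) => //.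
      exact: bigcupT_measurable.
    move=> m n mn; apply/subsetPset => u [i /= im iu]; exists i => //=.
    move: im; rewrite !mem_filter => /andP[-> /=]; rewrite !mem_iota !add0n.
    by move=> /leq_trans; exact.
  rewrite UE; apply: (closed_cvg grid closed_grid _ _ cU).
  by apply: nearW => n; exact: lV.
apply: measurableC; apply: countable_bigcupT_measurable => // s.
apply: measurableC; rewrite -[X in measurable X]setTI.
apply: (@measurable_eval _ X (@approximable_open R X) (V s)) => //.
rewrite (_ : grid = \bigcup_(z in grid) [set z]); last first.
  by apply/seteqP; split=> [z gz|z [y gy ->]//]; exists z.
apply: fin_bigcup_measurable => [|z _]; first exact: finite_grid.
exact: emeasurable_set1.
Qed.

End empirical.

(** * Mixtures of samplings without replacement *)

Section measurable_families.
Variables (R : realType) (X : polishType R).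
Context d (T : measurableType d).
Local Open Scope ereal_scope.

(** The identity; its target carries the sigma-algebra generated by evaluations at measurable sets
    instead of the Borel sets of the narrow topology. *)
Definition to_giry (Y : ptopologicalType) (mu : Prob R Y) : giry (borel Y) R :=
  mu.

Lemma measurable_to_giry (Y : ptopologicalType) (f : T -> Prob R Y) :
  (forall A : set (borel Y), measurable A ->
    measurable_fun setT (fun t => f t A)) ->
  measurable_fun setT (fun t => to_giry (f t)).
Proof. by move=> mf; exact: measurable_giry_codensity. Qed.

Lemma measurable_tensor m n k (mnk : (m + n)%N = k)
    (f : T -> Prob R (pow X m)) (g : T -> Prob R (pow X n)) :
  (forall A : set (borel (pow X m)), measurable A ->
    measurable_fun setT (fun t => f t A)) ->
  (forall A : set (borel (pow X n)), measurable A ->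
    measurable_fun setT (fun t => g t A)) ->
  forall A : set (borel (pow X k)), measurable A ->
    measurable_fun setT (fun t => tensor mnk (f t) (g t) A).
Proof.
move=> /measurable_to_giry mf /measurable_to_giry mg A mA.
have mB := measurable_preimage_concat mnk mA.
pose fg t : giry (borel (pow X m)) R * giry (borel (pow X n)) R :=
  (to_giry (f t), to_giry (g t)).
have mp : measurable_fun setT fg by exact: measurable_fun_pair.
have mfg : measurable_fun setT (giry_prod \o fg).
  by apply: measurableT_comp mp; exact: measurable_giry_prod.
by have := measurableT_comp (measurable_giry_ev (R := R) mB) mfg.
Qed.

End measurable_families.

Section measurable_FNk.
Variables (R : realType) (X : polishType R).
Local Open Scope ereal_scope.

Lemma measurable_id_image n (A : set (borel (pow X n))) : measurable A ->
  measurable_fun setT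
    ((fun lambda => id_image n lambda A) : borel (Prob R X) -> \bar R).
Proof.
move=> mA; apply: (@measurable_eval _ X (@approximable_open R X)).
exact: measurable_preimage_diag.
Qed.

Lemma measurable_mpow n (A : set (borel (pow X n))) : measurable A ->
  measurable_fun setT
    ((fun lambda => mpow lambda n A) : borel (Prob R X) -> \bar R).
Proof.
elim: n A => [|n IH] A mA; first exact: measurable_cst.
apply: (@measurable_tensor R X _ (borel (Prob R X)) 1 n _ _
  (fun lambda => id_image 1 lambda) (fun lambda => mpow lambda n)) => //.
exact: measurable_id_image.
Qed.

Lemma measurable_id_tensor p (A : set (borel (pow X (sumn p)))) :
  measurable A -> measurable_fun setT
    ((fun lambda => id_tensor lambda p A) : borel (Prob R X) -> \bar R).
Proof.
elim: p A => [|m p IH] A mA; first exact: measurable_cst.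
apply: (@measurable_tensor R X _ (borel (Prob R X)) m (sumn p) _ _
  (fun lambda => id_image m lambda) (fun lambda => id_tensor lambda p)) => //.
exact: measurable_id_image.
Qed.

Lemma measurable_FNk N k (A : set (borel (pow X k))) : measurable A ->
  measurable_fun setT
    ((fun lambda => FNk N k lambda A) : borel (Prob R X) -> \bar R).
Proof.
move=> mA; under eq_fun do rewrite FNk_valE.
apply: measurable_funeM; apply: emeasurable_funD; first exact: measurable_mpow.
apply: emeasurable_sum => j; apply: measurable_funeM; apply: measurable_funeM.
apply: emeasurable_sum => s; apply: emeasurable_sum => p.
apply: measurable_funeM.
apply: (@measurable_tensor R X _ (borel (Prob R X)) _ _ _ _
  (fun lambda => id_tensor lambda _) (fun lambda => mpow lambda _)).
- by move=> B; exact: measurable_id_tensor.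
- by move=> B; exact: measurable_mpow.
- exact: measurable_preimage_permute.
Qed.

End measurable_FNk.

(** * Counting and truncating injective sequences *)

Lemma size_injseqs (T : finType) r : size (injseqs T r) = (#|T| ^_ r)%N.
Proof.
elim: r => //= r IH; rewrite size_allpairs_dep sumnE big_map big_seq.
rewrite (eq_bigr (fun=> #|T| - r)%N) => [|u].
  by rewrite -big_seq big_const_seq count_predT iter_addn_0 IH ffactnSr mulnC.
rewrite mem_injseqs => /andP[uu /eqP <-]; rewrite size_filter.
rewrite -(card_uniqP uu) -(cardC (mem u)) addKn cardE size_filter enumT.
exact: eq_count.
Qed.

(** An injective sequence of length [r] has [#|T| - r] extensions by a last letter. Since [injseqs]
    prepends letters, the list is first reordered as one built with [rcons]. *)
Lemma sum_injseqs_take (R : numFieldType) (T : finType) r (H : seq T -> R) :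
  \sum_(t <- injseqs T r.+1) H (take r t) =
  (#|T| - r)%:R * \sum_(t <- injseqs T r) H t.
Proof.
pose L := [seq rcons u y | u <- injseqs T r,
                           y <- [seq y <- enum T | y \notin u]].
have LE : perm_eq (injseqs T r.+1) L.
  apply: uniq_perm; first exact: injseqs_uniq.
    apply: allpairs_uniq_dep => [|u _|]; first exact: injseqs_uniq.
      by rewrite filter_uniq ?enum_uniq.
    by move=> [u y] [v z] _ _ /= /rcons_inj[-> ->].
  move=> t; rewrite mem_injseqs; apply/idP/allpairsPdep.
    case/lastP: t => [|u y]; first by rewrite andbF.
    rewrite rcons_uniq size_rcons eqSS => /andP[/andP[yu uu] su].
    by exists u, y; rewrite mem_injseqs uu su mem_filter yu mem_enum.
  move=> [u [y [+ + ->]]]; rewrite mem_injseqs mem_filter.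
  move=> /andP[uu su] /andP[yu _].
  by rewrite rcons_uniq size_rcons eqSS yu uu su.
rewrite (perm_big _ LE) big_allpairs_dep mulr_sumr big_seq [RHS]big_seq.
apply: eq_bigr => u; rewrite mem_injseqs => /andP[uu /eqP su].
rewrite (eq_bigr (fun=> H u)) => [|y _].
  rewrite big_const_seq count_predT iter_addr_0 mulr_natl; congr (_ *+ _).
  rewrite -su -(card_uniqP uu) -(cardC (mem u)) addKn cardE !size_filter enumT.
  exact: eq_count.
by rewrite -cats1 -su take_size_cat.
Qed.

(** The first [k] draws of an exhaustive sampling form a sampling of size [k]; the later draws are
    dropped one at a time. *)
Lemma average_injseqs_take (R : numFieldType) (T : finType) k (H : seq T -> R) :
  (k <= #|T|)%N ->
  (( #|T| )`!)%:R^-1 * \sum_(t <- injseqs T #|T|) H (take k t) =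
  (#|T| ^_ k)%:R^-1 * \sum_(t <- injseqs T k) H t.
Proof.
move=> kT; rewrite -ffactnn; set n := #|T|.
suff : forall r, (k <= r <= n)%N ->
    (n ^_ r)%:R^-1 * \sum_(t <- injseqs T r) H (take k t) =
    (n ^_ k)%:R^-1 * \sum_(t <- injseqs T k) H t.
  by apply; rewrite kT leqnn.
elim=> [|r IH] /andP[kr rn].
  have -> : k = 0%N by move: kr; rewrite leqn0 => /eqP.
  by rewrite !big_seq1.
move: kr; rewrite leq_eqVlt => /predU1P[->|kr].
  congr (_ * _); rewrite big_seq [RHS]big_seq; apply: eq_bigr => t.
  by rewrite mem_injseqs => /andP[_ /eqP <-]; rewrite take_size.
rewrite -IH; last by apply/andP; split; [exact: kr|exact: ltnW].
have -> : \sum_(t <- injseqs T r.+1) H (take k t) =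
    \sum_(t <- injseqs T r.+1) H (take k (take r t)).
  by apply: eq_bigr => t _; rewrite take_takel.
rewrite (sum_injseqs_take r (fun t => H (take k t))) ffactnSr natrM invfM.
by rewrite mulrA mulfVK// pnatr_eq0 -lt0n subn_gt0.
Qed.

Section average_dirac.
Variables (R : realType) (Y : ptopologicalType).
Local Open Scope ereal_scope.

(** Normalizing gives a probability measure for every list; the empty list yields the default
    [dirac point]. *)
Definition average_dirac (l : seq (borel Y)) : Prob R Y :=
  mnormalize (msum (fun i => \d_(nth point l i)) (size l)) (dirac point).

Lemma average_diracE (l : seq (borel Y)) (A : set (borel Y)) :
  (0 < size l)%N -> average_dirac l A =
  ((size l)%:R^-1 * \sum_(z <- l) \1_A z)%:E.
Proof.
move=> l0; pose m : {measure set (borel Y) -> \bar R} :=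
  msum (fun i => \d_(nth point l i)) (size l).
have sE (B : set (borel Y)) : m B = (\sum_(z <- l) \1_B z)%:E.
  by rewrite /m /= /msum -sumEFin (big_nth point) big_mkord.
have -> : average_dirac l A = mnormalize m (dirac point) A by [].
rewrite /mnormalize sE.
rewrite (eq_bigr (fun=> 1%R)) => [|z _]; last by rewrite indicT.
rewrite big_const_seq count_predT iter_addr_0 eqe pnatr_eq0 gtn_eqF//=.
by rewrite sE mulrC.
Qed.

End average_dirac.

Section cintegral_measure.
Context d (T : measurableType d) (R : realType).

(** On the negative set of any Hahn decomposition, a charge equal to a measure is both nonpositive
    and nonnegative, so its negative part vanishes. *)
Lemma cintegral_measure (nu : {charge set T -> \bar R})
    (mu : {measure set T -> \bar R}) (f : T -> R) :
  (forall A, measurable A -> nu A = mu A) -> cintegral nu f = \int[mu]_x f x.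
Proof.
move=> numu; rewrite /cintegral.
set P := cid _; set N := cid _; set h := svalP N.
have [[mP _] [mN N0] PN PN0] := h.
have negE A : measurable A -> jordan_neg h A = 0%E.
  move=> mA; rewrite jordan_negE cjordan_negE /crestr0 mem_set//.
  have mAN : measurable (A `&` sval N) by exact: measurableI.
  rewrite /crestr; apply/eqP; rewrite oppe_eq0 eq_le N0//=.
  by rewrite numu.
have posE A : measurable A -> jordan_pos h A = mu A.
  move=> mA; rewrite -numu// (jordan_decomp h mA) /cadd /= cscaleN1 /=.
  by have := negE A mA; rewrite jordan_negE => ->; rewrite oppe0 adde0.
rewrite /Rintegral (eq_measure_integral mu); last by move=> A mA _; exact: posE.
rewrite (eq_measure_integral mzero (m1 := jordan_neg h)); last first.
  by move=> A mA _; exact: negE.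
by rewrite integral_measure_zero subr0.
Qed.

End cintegral_measure.

(** * Samplings from an empirical measure and their mixtures *)

Section sampling.
Variables (R : realType) (X : polishType R) (N : nat).
Local Open Scope ereal_scope.

Definition sample k (x : 'I_N -> X) : Prob R (pow X k) :=
  average_dirac R [seq seq_pow k (map x t) | t <- injseqs 'I_N k].

Lemma sampleE k (x : 'I_N -> X) (A : set (borel (pow X k))) : (k <= N)%N ->
  sample k x A = ((N ^_ k)%:R^-1 *
    \sum_(t <- injseqs 'I_N k) \1_A (seq_pow k (map x t)))%:E.
Proof.
move=> kN; rewrite average_diracE size_map size_injseqs card_ord ?ffact_gt0//.
by rewrite big_map.
Qed.

(** The tuple is chosen without regard to measurability: by [FNk_sample], the resulting sampling law
    of an empirical [lambda] does not depend on the choice. *)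
Definition atoms (lambda : Prob R X) : 'I_N -> X :=
  xget (fun=> point) [set x | emp_measure x lambda].

Lemma atomsP (lambda : Prob R X) :
  empirical N lambda -> emp_measure (atoms lambda) lambda.
Proof.
by move=> [x xl]; rewrite /atoms; case: xgetP => [y _ //|/(_ x)]; case.
Qed.

Lemma atoms_default (lambda : Prob R X) :
  ~ empirical N lambda -> atoms lambda = fun=> point.
Proof. by move=> nl; apply: xgetPN => x xl; apply: nl; exists x. Qed.

Variable k : nat.
Hypotheses (k0 : (0 < k)%N) (kN : (k <= N)%N).

Lemma FNk_sample (x : 'I_N -> X) (lambda : Prob R X)
    (A : set (borel (pow X k))) : emp_measure x lambda -> measurable A ->
  FNk N k lambda A = sample k x A.
Proof. by move=> xl mA; rewrite sampleE// (FNk_empirical k0 kN xl). Qed.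

(** The value agrees with the measurable [FNk] on the Borel set of empirical measures and is
    constant elsewhere, where [atoms] takes its default value. *)
Lemma measurable_sample_atoms (A : set (borel (pow X k))) : measurable A ->
  measurable_fun setT
    ((fun lambda => sample k (atoms lambda) A) : borel (Prob R X) -> \bar R).
Proof.
move=> mA; have mN := @measurable_empirical R X N (leq_trans k0 kN).
pose E := empirical N : set (borel (Prob R X)).
apply: (eq_measurable_fun (fun lambda : borel (Prob R X) =>
    FNk N k lambda A * (\1_E lambda)%:E +
    sample k (fun _ : 'I_N => point) A * (\1_(~` E) lambda)%:E)).
  move=> lambda _; rewrite !indicE in_setC.
  have [El|El] := boolP (lambda \in E).
    by rewrite mule1 mule0 adde0 (FNk_sample (atomsP _))// -in_setE.
  by rewrite mule0 mule1 add0e atoms_default//; rewrite notin_setE in El.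
apply: emeasurable_funD; apply: emeasurable_funM.
- exact: measurable_FNk.
- by apply/measurable_EFinP; exact: measurable_indic.
- exact: measurable_cst.
- by apply/measurable_EFinP; apply: measurable_indic; exact: measurableC.
Qed.

Let measurable_sample := measurable_to_giry measurable_sample_atoms.

Definition mixture (alpha : Prob R (Prob R X)) : giry (borel (pow X k)) R :=
  giry_bind (to_giry alpha) measurable_sample.

Lemma integral_mixture (alpha : Prob R (Prob R X))
    (f : borel (pow X k) -> \bar R) :
  measurable_fun setT f -> (forall y, 0 <= f y) ->
  \int[mixture alpha]_y f y =
  \int[alpha]_lambda \int[sample k (atoms lambda)]_y f y.
Proof.
by move=> mf f0; exact: (giry_int_bind (to_giry alpha) measurable_sample).
Qed.

Lemma mixtureE (alpha : Prob R (Prob R X)) (A : set (borel (pow X k))) :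
  measurable A ->
  mixture alpha A = \int[alpha]_lambda sample k (atoms lambda) A.
Proof.
move=> mA; have i1 (mu : {measure set (borel (pow X k)) -> \bar R}) :
    mu A = \int[mu]_y (\1_A y)%:E.
  by rewrite integral_indic// setIT.
rewrite i1 integral_mixture//.
  by apply: eq_integral => lambda _; exact/esym/i1.
by apply/measurable_EFinP; exact: measurable_indic.
Qed.

Lemma integral_empirical (alpha : Prob R (Prob R X))
    (f : borel (Prob R X) -> \bar R) : alpha (empirical N) = 1 ->
  measurable_fun setT f -> (forall l, 0 <= f l) ->
  \int[alpha]_l f l = \int[alpha]_(l in empirical N) f l.
Proof.
move=> aN mf f0; have mN := @measurable_empirical R X N (leq_trans k0 kN).
rewrite (@ge0_negligible_integral _ (borel (Prob R X)) _ _ _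
  (~` (empirical N : set (Prob R X))))//.
- by rewrite setTD setCK.
- exact: measurableC.
- by apply: (eq_trans (probability_setC alpha mN)); rewrite aN subee.
Qed.

End sampling.
Arguments atoms {R X} N lambda _.

Section shift.
Context d (T : measurableType d) (R : realType) (P : probability T R).

Lemma Rintegral_shift (D : set T) (f : T -> R) (M : R) : measurable D ->
  P D = 1%E -> P.-integrable D (EFin \o f) ->
  \int[P]_(x in D) (f x - M) = \int[P]_(x in D) f x - M.
Proof.
move=> mD PD fi; rewrite RintegralB//; last first.
  exact: finite_measure_integrable_cst.
rewrite Rintegral_cst//; congr (_ - _); rewrite -[RHS]mulr1; congr (_ * _).
exact: (congr1 fine PD).
Qed.

End shift.

(** * The integral formula as equality with a mixture *)

Section represents.
Variables (R : realType) (X : polishType R) (N k : nat).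
Hypotheses (k0 : (0 < k)%N) (kN : (k <= N)%N).
Variable alpha : Prob R (Prob R X).
Hypothesis alphaN : alpha (empirical N) = 1%E.

Let mN := @measurable_empirical R X N (leq_trans k0 kN).

Lemma cintegral_FNk (lambda : Prob R X) (f : pow X k -> R) :
  empirical N lambda ->
  cintegral (FNk N k lambda) f = \int[sample k (atoms N lambda)]_y f y.
Proof.
move=> lN; apply: cintegral_measure => A mA.
exact: (FNk_sample k0 kN (atomsP lN)).
Qed.

Let F (f : pow X k -> R) (lambda : borel (Prob R X)) : \bar R :=
  (\int[sample k (atoms N lambda)]_y (f y)%:E)%E.

Let measurable_F f : bounded_continuous f -> (forall y, 0 <= f y) ->
  measurable_fun setT (F f).
Proof.
move=> [cf _] f0; apply: (measurableT_comp (measurable_giry_int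
  (T := borel (pow X k)) (f := EFin \o f) _ _)).
- apply/measurable_EFinP.
  exact: (@continuous_borel_measurable R (pow X k) _ cf).
- by move=> y; rewrite lee_fin.
- exact: measurable_to_giry (measurable_sample_atoms k0 kN).
Qed.

Let F_ge0 f l : (forall y, 0 <= f y) -> (0 <= F f l)%E.
Proof. by move=> f0; apply: integral_ge0 => y _; rewrite lee_fin. Qed.

Let F_fin f l : bounded_continuous f -> F f l \is a fin_num.
Proof.
move=> bf; apply: integrable_fin_num => //.
exact: bounded_continuous_integrable.
Qed.

Lemma Rintegral_mixture (f : pow X k -> R) :
  bounded_continuous f -> (forall y, 0 <= f y) ->
  \int[alpha]_(lambda in empirical N) cintegral (FNk N k lambda) f =
  \int[mixture k0 kN alpha]_y f y.
Proof.
move=> bf f0; congr fine.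
rewrite integral_mixture; last 2 first.
- case: bf => cf _; apply/measurable_EFinP.
  exact: (@continuous_borel_measurable R (pow X k) _ cf).
- by move=> y; rewrite lee_fin.
rewrite (integral_empirical k0 kN alphaN (measurable_F bf f0)); last first.
  by move=> l; exact: F_ge0.
apply: eq_integral => lambda; rewrite inE => lN.
by rewrite cintegral_FNk// fineK//; exact: F_fin.
Qed.

(** Nonnegative test functions determine a Borel measure, which gives one direction. Conversely each
    test function is shifted to a nonnegative one, to which [Rintegral_mixture] applies. *)
Lemma representsP (mu : Prob R (pow X k)) : represents N alpha mu <->
  forall A : set (borel (pow X k)), measurable A ->
    mu A = mixture k0 kN alpha A.
Proof.
have approx U : open U -> @approximable R (pow X k) U.
  exact: pow_open_approximation.
split=> [[_ muE]|muE].
  apply: (eq_measure_bounded_continuous approx) => f bf f0.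
  have mi : (mixture k0 kN alpha).-integrable setT (EFin \o f).
    apply: measurable_bounded_integrable => //.
    - rewrite (le_lt_trans (@sprobability_setT _ (borel (pow X k)) R
        (mixture k0 kN alpha)))//.
      by rewrite ltry.
    - by apply: (@continuous_borel_measurable R (pow X k)); case: bf.
    - by case: bf.
  have E : \int[mu]_y f y = \int[mixture k0 kN alpha]_y f y.
    by rewrite (muE f bf) Rintegral_mixture.
  have E' := congr1 (@EFin R) E; rewrite /Rintegral in E'.
  have mu_fin := integrable_fin_num measurableT
    (bounded_continuous_integrable mu bf).
  have mix_fin := integrable_fin_num measurableT mi.
  by rewrite (fineK mu_fin) (fineK mix_fin) in E'.
split=> // f bf.
have [M [bg g_ge0]] := bounded_continuous_shift bf.
pose g y := f y + M; have g0 y : 0 <= g y by exact: g_ge0.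
have [G gG] : exists G, forall y, `|g y| <= G.
  by apply/bounded_fun_ex; case: bg.
have gM y : g y <= G by exact: le_trans (ler_norm _) (gG y).
have fE (P : Prob R (pow X k)) : \int[P]_y f y = \int[P]_y g y - M.
  rewrite -(@Rintegral_shift _ (borel (pow X k)) R P setT g M measurableT
    (probability_setT P) (bounded_continuous_integrable P bg)).
  by apply: eq_Rintegral => y _; rewrite /g addrK.
rewrite fE.
have -> : \int[mu]_y g y = \int[mixture k0 kN alpha]_y g y.
  by congr fine; apply: eq_measure_integral => A mA _; exact: muE.
rewrite -Rintegral_mixture// -(@Rintegral_shift _ (borel (Prob R X)))//.
  apply: eq_Rintegral => lambda; rewrite inE => lN.
  by rewrite !cintegral_FNk// fE.
(* [F g] is integrable since the bound [G] of [g] also bounds its mean under each sampling law. *)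
apply: (@eq_integrable _ (borel (Prob R X)) _ _ _ mN (F g)).
  move=> lambda; rewrite inE => lN; rewrite /= cintegral_FNk// fineK//.
  exact: F_fin.
apply: (@integrableS _ (borel (Prob R X)) _ _ setT) => //.
apply: (@le_integrable _ (borel (Prob R X)) _ _ _ _ _ (EFin \o cst G)) => //.
- exact: measurable_F.
- move=> l _; rewrite gee0_abs ?F_ge0//= ger0_norm//; last first.
    exact: le_trans (g0 point) (gM point).
  apply: (@le_trans _ _ (\int[sample k (atoms N l)]_y G%:E)%E).
    apply: ge0_le_integral => //.
    - by move=> y _; rewrite lee_fin.
    - apply/measurable_EFinP; case: bg => cg _.
      exact: (@continuous_borel_measurable R (pow X k) _ cg).
    - by move=> y _; rewrite lee_fin.
  rewrite integral_cst// [X in (_ * X)%E](_ : _ = 1%E) ?mule1//.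
  exact: probability_setT.
- exact: finite_measure_integrable_cst.
Qed.

End represents.

Lemma restrict_seq_pow (X : ptopologicalType) N k (kN : (k <= N)%N)
    (t : seq X) : Defs.restrict kN (seq_pow N t) = seq_pow k (take k t).
Proof. by apply/funext => i; rewrite /Defs.restrict /seq_pow nth_take. Qed.

(** * Marginals and symmetry of samplings *)

Section sample_symmetry.
Variables (R : realType) (X : polishType R) (N : nat).
Hypothesis N0 : (0 < N)%N.
Implicit Types x : 'I_N -> X.

Lemma sample_restrict k (kN : (k <= N)%N) x (A : set (borel (pow X k))) :
  sample k x A = sample N x (Defs.restrict kN @^-1` A) :> \bar R.
Proof.
rewrite !sampleE//; congr EFin.
pose H t : R := \1_A (seq_pow k (map x t)).
have := @average_injseqs_take R 'I_N k H; rewrite card_ord => /(_ kN).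
rewrite /H => <-; rewrite ffactnn; congr (_ * _).
apply: eq_bigr => t _; rewrite map_take -(@restrict_seq_pow X N k kN).
by [].
Qed.

Lemma sample_permute x (s : {perm 'I_N}) (A : set (borel (pow X N))) :
  sample N x (permute s @^-1` A) = sample N x A :> \bar R.
Proof.
pose i0 := Ordinal N0.
rewrite !sampleE//; congr (_ * _)%:E.
pose G t : R := \1_A (seq_pow N (map x t)).
transitivity (\sum_(t <- injseqs 'I_N N) G (permute_seq i0 s t)).
  rewrite big_seq [RHS]big_seq; apply: eq_bigr => t.
  rewrite mem_injseqs => /andP[_ /eqP tN].
  by rewrite /G -permute_seq_pow.
apply: big_permute_seq; first exact: injseqs_uniq.
  by move=> t; rewrite mem_injseqs => /andP[_ /eqP].
by move=> t u tu; rewrite !mem_injseqs (perm_uniq tu) (perm_size tu).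
Qed.

Lemma injseqs_perm (t : seq 'I_N) : t \in injseqs 'I_N N ->
  exists s : {perm 'I_N}, forall x, seq_pow N (map x t) = permute s x.
Proof.
rewrite mem_injseqs => /andP[ut /eqP tN]; pose i0 := Ordinal N0.
have inj : injective (fun i : 'I_N => nth i0 t i).
  move=> i j /eqP; rewrite nth_uniq ?tN// => /eqP ij; exact: val_inj.
exists (perm inj) => x; apply/funext => i.
by rewrite /seq_pow /permute permE (nth_map i0)// tN.
Qed.

Lemma symmetrizeE (nu : {charge set (borel (pow X N)) -> \bar R})
    (A : set (borel (pow X N))) :
  symmetrize nu A = ((N`!%:R^-1)%:E * \sum_(s <- index_enum {perm 'I_N})
    nu (permute s @^-1` A))%E.
Proof. by []. Qed.

(** Replacing [A] by its preimage under [permute s] only translates the sum over the group in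
    [symmetrize]. *)
Lemma symmetric_permute (gamma : Prob R (pow X N)) (s : {perm 'I_N})
    (A : set (borel (pow X N))) : Defs.symmetric gamma -> measurable A ->
  gamma (permute s @^-1` A) = gamma A.
Proof.
move=> gs mA; have mB := measurable_preimage_permute s mA.
rewrite -(gs _ mA) -(gs _ mB) !symmetrizeE; congr (_ * _)%E.
rewrite [RHS](reindex_inj (mulgI s)) /=; apply: eq_bigr => s' _.
rewrite /cimage /pushforward /=; congr (gamma _).
by apply/seteqP; split=> x /=; congr A; apply/funext => i;
  rewrite /permute permM.
Qed.

Lemma permute_symmetric (gamma : Prob R (pow X N)) :
  (forall (s : {perm 'I_N}) (A : set (borel (pow X N))), measurable A ->
    gamma (permute s @^-1` A) = gamma A) -> Defs.symmetric gamma.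
Proof.
move=> gs A mA; rewrite symmetrizeE.
have gA : gamma A \is a fin_num by exact: fin_num_measure.
rewrite (eq_bigr (fun=> (fine (gamma A))%:E)) => [|s _]; last first.
  by rewrite fineK// -(gs s A mA).
rewrite sumEFin sumr_const card_Sn -EFinM -[X in _ * X]mulr_natl mulKf ?fineK//.
Qed.

(** An injective sequence of full length is a permutation [s], and its term integrates to the mass
    of the preimage of [A] under [permute s], which is [gamma A] by symmetry. *)
Lemma integral_sample (gamma : Prob R (pow X N)) (A : set (borel (pow X N))) :
  Defs.symmetric gamma -> measurable A ->
  (\int[gamma]_x sample N x A)%E = gamma A.
Proof.
move=> gs mA.
have mt t : measurable_fun setT ((fun x => seq_pow N (map x t)) :
    borel (pow X N) -> borel (pow X N)).
  apply: measurable_pow => i.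
  have [it|it] := ltnP i (size t); last first.
    rewrite (_ : (fun _ => _) = cst point); first exact: measurable_cst.
    by apply/funext => x; rewrite /seq_pow nth_default// size_map.
  rewrite (_ : (fun _ => _) = (fun x => x (nth (Ordinal N0) t i))).
    exact: measurable_coord.
  by apply/funext => x; rewrite /seq_pow (nth_map (Ordinal N0)).
under eq_integral do rewrite sampleE//.
transitivity ((N ^_ N)%:R^-1%:E * \sum_(t <- injseqs 'I_N N)
    \int[gamma]_x (\1_A (seq_pow N (map x t)))%:E)%E.
  rewrite -ge0_integral_sum//; last first.
    move=> t; apply/measurable_EFinP.
    exact: measurableT_comp (measurable_indic mA) (mt t).
  rewrite -ge0_integralZl//; last 2 first.
  - apply: emeasurable_sum => t; apply/measurable_EFinP.
    exact: measurableT_comp (measurable_indic mA) (mt t).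
  - by move=> x _; apply: sume_ge0 => t _; rewrite lee_fin.
  by apply: eq_integral => x _; rewrite EFinM -sumEFin.
have gA : gamma A \is a fin_num by exact: fin_num_measure.
rewrite big_seq (eq_bigr (fun=> (fine (gamma A))%:E)) =>
  [|t /injseqs_perm[s sE]].
  rewrite -big_seq sumEFin big_const_seq count_predT size_injseqs card_ord.
  rewrite iter_addr_0 -EFinM -[X in _ * X]mulr_natl mulKf ?fineK//.
  by rewrite pnatr_eq0 -lt0n ffact_gt0.
rewrite fineK// -(symmetric_permute s gs mA).
have mB := measurable_preimage_permute s mA.
rewrite -[in RHS](setIT (permute s @^-1` A)) -integral_indic//.
by apply: eq_integral => x _; rewrite sE.
Qed.

Lemma measurable_preimage_restrict k (kN : (k <= N)%N)
    (A : set (borel (pow X k))) : measurable A ->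
  measurable (Defs.restrict kN @^-1` A : set (borel (pow X N))).
Proof.
move=> mA; rewrite -[X in measurable X]setTI.
exact: (@Defs.measurable_restrict R X k N kN).
Qed.

Lemma marginalE k (kN : (k <= N)%N) (gamma : Prob R (pow X N))
    (A : set (borel (pow X k))) :
  marginal kN gamma A = gamma (Defs.restrict kN @^-1` A).
Proof. by []. Qed.

End sample_symmetry.

(** * Empirical measures and the theorem *)

Section empirical_measure.
Variables (R : realType) (X : polishType R) (N : nat).
Hypothesis N0 : (0 < N)%N.

Definition emp_of (x : pow X N) : Prob R X :=
  average_dirac R [seq x i | i <- enum 'I_N].

Lemma size_emp_of (x : pow X N) : size [seq x i | i <- enum 'I_N] = N.
Proof. by rewrite size_map size_enum_ord. Qed.

Lemma emp_of_average (x : pow X N) (A : set (borel X)) : emp_of x A =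
  (N%:R^-1 * \sum_(z <- [seq x i | i <- enum 'I_N]) \1_A z)%:E.
Proof. by rewrite average_diracE size_emp_of. Qed.

Lemma emp_ofE (x : pow X N) : emp_measure x (emp_of x).
Proof.
move=> A mA; rewrite emp_of_average EFinM big_map big_enum /=.
by rewrite -sumEFin.
Qed.

Lemma emp_of_empirical (x : pow X N) : empirical N (emp_of x).
Proof. by exists x; exact: emp_ofE. Qed.

Lemma Rintegral_emp_of (x : pow X N) (f : X -> R) : bounded_continuous f ->
  \int[emp_of x]_y f y = N%:R^-1 * \sum_(i < N) f (x i).
Proof.
move=> bf; have [M [bg g_ge0]] := bounded_continuous_shift bf.
pose g y := f y + M; have g0 y : 0 <= g y by exact: g_ge0.
transitivity (\int[emp_of x]_y (g y - M)).
  by apply: eq_Rintegral => y _; rewrite /g addrK.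
rewrite (@Rintegral_shift _ (borel X) R (emp_of x) setT g M measurableT
  (probability_setT _) (bounded_continuous_integrable _ bg)).
have mg : measurable_fun setT (EFin \o g : borel X -> \bar R).
  apply/measurable_EFinP; case: bg => cg _.
  exact: (@continuous_borel_measurable R X _ cg).
rewrite /Rintegral (@ge0_integral_discrete _ (borel X) R (emp_of x) N%:R^-1
  [seq x i | i <- enum 'I_N] (EFin \o g))//; last first.
  by move=> A _; exact: emp_of_average.
rewrite sumEFin -EFinM /= big_map big_enum /= big_split /= mulrDr.
rewrite sumr_const card_ord -[M *+ N]mulr_natl mulKf ?addrK//.
by rewrite pnatr_eq0 -lt0n.
Qed.

Lemma continuous_Rintegral_emp_of (f : X -> R) : bounded_continuous f ->
  continuous (fun x : pow X N => \int[emp_of x]_y f y).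
Proof.
move=> bf; rewrite (_ : (fun _ => _) =
    (fun x : pow X N => N%:R^-1 * \sum_(i < N) f (x i))); last first.
  by apply/funext => x; rewrite Rintegral_emp_of.
move=> x; apply: (@cvgMl_tmp R _ (nbhs (x : pow X N)) _
  (fun y : pow X N => \sum_(i < N) f (y i)) N%:R^-1 (\sum_(i < N) f (x i))).
elim: (index_enum _) => [|i r IH].
  rewrite big_nil (_ : (fun _ => _) = fun=> 0); first exact: cvg_cst.
  by apply/funext => y; rewrite big_nil.
rewrite big_cons (_ : (fun _ => _) =
  (fun y : pow X N => f (y i) + \sum_(j <- r) f (y j))); last first.
  by apply/funext => y; rewrite big_cons.
have ci : f (y i) @[y --> (x : pow X N)] --> f (x i).
  apply: (@cvg_comp _ _ _ (fun y : pow X N => y i) f _ (nbhs (x i))).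
    exact: (@proj_continuous _ (fun=> X) i x).
  by case: bf => cf _; exact: cf.
exact: (@cvgD R R^o _ (nbhs x) _ (fun y : pow X N => f (y i)) _ _ _ ci IH).
Qed.

(** The integral of a test function against [emp_of x] is the average of its values at the
    coordinates of [x], hence continuous in [x]. *)
Lemma continuous_emp_of : continuous (emp_of : pow X N -> Prob R X).
Proof.
move=> x.
have := (@narrow_cvgP R X (emp_of @ nbhs (x : pow X N)) (emp_of x)
  (fmap_filter _ (nbhs_filter (x : pow X N)))).2; apply => f bf.
exact: continuous_Rintegral_emp_of.
Qed.

Lemma measurable_emp_of :
  measurable_fun setT (emp_of : borel (pow X N) -> borel (Prob R X)).
Proof. exact: continuous_borel continuous_emp_of. Qed.

(* Two representations of an empirical measure may differ as functions on
   non-Borel sets, hence as points of [Prob R X]. *)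
Lemma borel_indistinguishable (lambda lambda' : Prob R X)
    (B : set (borel (Prob R X))) : measurable B ->
  (forall A : set (borel X), measurable A -> lambda A = lambda' A) ->
  B lambda <-> B lambda'.
Proof.
move=> mB ll'; have : <<s @open (Prob R X) >> B by [].
apply: (@dynkin_induction _ (borel (Prob R X)) (@open (Prob R X))
  [set B | B lambda <-> B lambda']) => //=.
- by move=> U V oU oV; exact: openI.
- move=> U oU.
  have bE : @bc_integrals R X lambda = @bc_integrals R X lambda'.
    apply/funext => f; congr fine; apply: eq_measure_integral => A mA _.
    exact: ll'.
  have sep (l l' : Prob R X) : @bc_integrals R X l = @bc_integrals R X l' ->
      U l -> U l'.
    move=> e Ul; have : nbhs l U by exact: open_nbhs_nbhs.
    rewrite nbhsE /= => -[_ [[D oD <-] Dl] DU]; apply: DU => /=.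
    by move: Dl; rewrite /= e.
  by split; apply: sep.
- by move=> S _ SE; rewrite SE.
- move=> F _ _ FE; split=> -[n _ Fn]; exists n => //; exact/FE.
Qed.

(** All orderings of [x] have the empirical measure [lambda], up to values on non-Borel sets, so the
    image of [sample N x] under [emp_of] is the Dirac mass at [lambda]. *)
Lemma sample_emp_of (x : 'I_N -> X) (lambda : Prob R X)
    (B : set (borel (Prob R X))) : emp_measure x lambda -> measurable B ->
  sample N x (emp_of @^-1` B) = (\1_B lambda)%:E :> \bar R.
Proof.
move=> xl mB; rewrite sampleE//; congr EFin.
rewrite big_seq (eq_bigr (fun=> \1_B lambda)) =>
  [|t /(@injseqs_perm R X N N0)[s sE]].
  rewrite -big_seq big_const_seq count_predT size_injseqs card_ord iter_addr_0.
  by rewrite -[X in _ * X]mulr_natl mulKf// pnatr_eq0 -lt0n ffact_gt0.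
have EB : B (emp_of (permute s x)) <-> B lambda.
  apply: borel_indistinguishable => // A mA.
  rewrite emp_ofE// xl//; congr (_ * _)%E.
  by rewrite [RHS](reindex_inj (@perm_inj _ s)).
rewrite sE !indicE; congr (nat_of_bool _)%:R.
by apply/idP/idP; rewrite !inE => /EB.
Qed.

End empirical_measure.

Lemma mnormalize_mass1 d (T : measurableType d) (R : realType)
    (mu : {measure set T -> \bar R}) (P : probability T R) (A : set T) :
  mu setT = 1%E -> mnormalize mu P A = mu A.
Proof. by move=> mu1; rewrite /mnormalize mu1 onee_eq0 /= invr1 mule1. Qed.

Theorem theorem5p1 (R : realType) (X : polishType R) (N k : nat)
    (k2 : (2 <= k)%N) (kN : (k <= N)%N) (mu : Prob R (pow X k)) :
  (representable kN mu <->
    exists alpha : Prob R (Prob R X), represents N alpha mu) /\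
  (k = N -> forall alpha beta : Prob R (Prob R X),
    represents N alpha mu -> represents N beta mu ->
    forall A : set (borel (Prob R X)), measurable A -> alpha A = beta A).
Proof.
have k0 : (0 < k)%N by exact: ltnW.
have N0 : (0 < N)%N by exact: leq_trans kN.
split; last first.
  move=> kN'; subst k => alpha beta am bm A mA.
  (* Any representing measure is the image of [mu] under [emp_of], which turns the mixture of
     sampling laws into a mixture of Dirac masses. *)
  have evalE (al : Prob R (Prob R X)) : represents N al mu ->
      al A = mu (@emp_of R X N @^-1` A).
    move=> alm; have [al1 _] := alm.
    have /(representsP N0 kN al1) muE := alm.
    have mB : measurable (@emp_of R X N @^-1` A : set (borel (pow X N))).
      by rewrite -[X in measurable X]setTI; exact: (measurable_emp_of N0).
    rewrite muE// mixtureE//.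
    rewrite (integral_empirical N0 kN al1); last 2 first.
    - exact: measurable_sample_atoms.
    - by move=> l; exact: measure_ge0.
    rewrite (eq_integral (fun l => (\1_A l)%:E)); last first.
      move=> l; rewrite inE => lN.
      exact: sample_emp_of (atomsP lN) mA.
    rewrite -(integral_empirical N0 kN al1); last 2 first.
    - by apply/measurable_EFinP; exact: measurable_indic.
    - by move=> l; rewrite lee_fin.
    by rewrite integral_indic// setIT.
  by rewrite !evalE.
split=> [[gamma [gs muE]]|[alpha am]].
  (* The law of the empirical measure of a point drawn from [gamma]. *)
  pose alpha : Prob R (Prob R X) :=
    distribution gamma (mfun_of (@measurable_emp_of R X N N0)).
  have al1 : alpha (empirical N) = 1%E.
    rewrite -(probability_setT gamma); congr (gamma _).
    by apply/seteqP; split=> // x _; exact: emp_of_empirical.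
  exists alpha; apply/(representsP k0 kN al1) => A mA.
  rewrite muE// mixtureE// marginalE.
  rewrite ge0_integral_distribution//; last exact: measurable_sample_atoms.
  rewrite -(integral_sample N0 gs (measurable_preimage_restrict kN mA)).
  apply: eq_integral => x _ /=; rewrite -(sample_restrict kN x A).
  (* The point [x] and the chosen atoms of its empirical measure may be ordered differently; both
     sampling laws are [FNk] at that empirical measure. *)
  rewrite -(FNk_sample k0 kN (emp_ofE N0 x) mA).
  by rewrite -(FNk_sample k0 kN (atomsP (emp_of_empirical N0 x)) mA).
have [al1 _] := am; have /(representsP k0 kN al1) muE := am.
have mix1 : mixture N0 (leqnn N) alpha setT = 1%E.
  rewrite mixtureE//.
  under eq_integral do rewrite probability_setT.
  by rewrite integral_cst// mul1e; exact: probability_setT.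
(* The mixture is typed as a subprobability; since its mass is one, normalizing only changes the
   type. *)
pose gamma : Prob R (pow X N) :=
  mnormalize (mixture N0 (leqnn N) alpha) (dirac point).
have gammaE A : gamma A = mixture N0 (leqnn N) alpha A.
  exact: (mnormalize_mass1 _ _ mix1).
exists gamma; split.
  apply: permute_symmetric => s A mA.
  have mB := measurable_preimage_permute s mA.
  rewrite !gammaE !mixtureE//; apply: eq_integral => l _.
  exact: (sample_permute N0).
move=> A mA; rewrite muE// marginalE gammaE.
rewrite !mixtureE//; last exact: measurable_preimage_restrict.
by apply: eq_integral => l _; exact: sample_restrict.
Qed.
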